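(* Let $m,n\in\mathbf{N}_0$, let $\mu$ be a partition of $m$, $\nu$ a partition of $n$, $\lambda$ a partition of $mn$ and let $r\in\mathbf{N}$. Let $E$ be a complex vector space of dimension $d$ where $d\ge r$ and $d\ge\ell(\mu)$. Let $L$ be the greater of \[ n(\mu_1+\cdots+\mu_{r-1})+(n-1)\mu_r+\mu_{r+1}-(\lambda_1+\cdots+\lambda_r) \] and $0$. Then \[ \bigl[\nabla^\nu\bigl(\nabla^{\mu+N(1^r)}(E)\bigr):\nabla^{\lambda+N(n^r)}(E)\bigr]\ \le\ \bigl|\{T\in\mathrm{SSYT}_{\mathcal{B}^{+L}}(\nu):\mathrm{wt}(T)=\lambda+L(n^r)\}\bigr| \] for all $N\in\mathbf{N}_0$ with $N\ge L$.
   Context: For partitions $\alpha,\beta$: $(\alpha+\beta)_i=\alpha_i+\beta_i$, $(N\alpha)_i=N\alpha_i$, with parts beyond the last equal to $0$; $\ell(\alpha)$ is the number of parts; $(a^r)$ is the partition with $r$ parts equal to $a$. $\nabla^\alpha$ is the Schur functor on complex polynomial representations of $\mathrm{GL}(E)$, normalised so that $\nabla^{(r)}=\mathrm{Sym}^r$ and $\nabla^{(1^r)}=\bigwedge^r$; for $\ell(\alpha)\le d$, $\nabla^\alpha(E)$ is the irreducible polynomial representation of highest weight $\alpha$, with character the Schur polynomial $s_\alpha(x_1,\ldots,x_d)$. $[W:\nabla^\alpha(E)]$ is the number of summands isomorphic to $\nabla^\alpha(E)$ in a decomposition of the polynomial representation $W$ into irreducibles (taken to be $0$ if $\ell(\alpha)>d$).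 A tableau with entries in a totally ordered set is semistandard if its rows weakly increase from left to right and its columns strictly increase from top to bottom. $\mathrm{SSYT}_{\mathcal{A}}(\alpha)$ is the set of semistandard $\alpha$-tableaux with entries in the totally ordered set $\mathcal{A}$. For $M\in\mathbf{N}_0$, $\mathcal{B}^{+M}=\mathrm{SSYT}_{\{1,\ldots,d\}}(\mu+M(1^r))$, totally ordered by: $t<u$ if and only if, in the rightmost column in which $t$ and $u$ differ, the greatest entry not appearing in both columns lies in $u$. So elements of $\mathrm{SSYT}_{\mathcal{B}^{+M}}(\nu)$ are semistandard $\nu$-tableaux whose entries are themselves semistandard $(\mu+M(1^r))$-tableaux. The weight $\mathrm{wt}(T)$ is the composition whose $b$th part is the total number of occurrences of $b$ in the tableau entries of $T$ (compositions differing by trailing zeros are identified). *)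

(* Defs.v *)
From HB Require Import structures.
From mathcomp Require Import all_boot all_order all_algebra all_fingroup.
From mathcomp Require Import boolp reals complex.

Set Implicit Arguments.
Unset Strict Implicit.
Unset Printing Implicit Defensive.

Import Order.TTheory GRing.Theory Num.Theory.
Local Open Scope ring_scope.

(** * Partitions *)

(* Parts are indexed from 0: alpha_i, for i >= 1, is [nth 0 al i.-1].         *)
Definition is_partition_of (n : nat) (al : seq nat) : bool :=
  [&& sorted geq al, 0%N \notin al & sumn al == n].

(* Zero parts are erased, so that e.g. N (n^r) is empty when N n = 0.         *)
Definition part_scale (N : nat) (al : seq nat) : seq nat :=
  [seq p <- [seq (N * a)%N | a <- al] | (0 < p)%N].

Definition part_add (al be : seq nat) : seq nat :=
  [seq p <- mkseq (fun i => (nth 0 al i + nth 0 be i)%N)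
                  (maxn (size al) (size be)) | (0 < p)%N].

(** * Young diagrams and semistandard tableaux *)

Definition box (al : seq nat) : finType :=
  {i : 'I_(size al) & 'I_(nth 0%N al i)}.

Definition box_row (al : seq nat) (b : box al) : nat := tag b.
Definition box_col (al : seq nat) (b : box al) : nat := tagged b.

(* [lt] is the strict order on the set of entries.                            *)
Definition semistandard (A : finType) (lt : rel A) (al : seq nat)
    (T : {ffun box al -> A}) : bool :=
  [forall x, forall y, (box_row x == box_row y) && (box_col x < box_col y)%N
     ==> (T x == T y) || lt (T x) (T y)]
  && [forall x, forall y, (box_col x == box_col y) && (box_row x < box_row y)%N
     ==> lt (T x) (T y)].

Definition SSYT (A : finType) (lt : rel A) (al : seq nat) :
  {set {ffun box al -> A}} := [set T | semistandard lt T].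

(* The alphabet {1, ..., d} is 'I_d, with b : 'I_d standing for b + 1.        *)
Definition ord_lt (d : nat) : rel 'I_d := fun i j => (i < j)%N.

Definition ssyt_type (d : nat) (al : seq nat) : finType :=
  {t : {ffun box al -> 'I_d} | t \in SSYT (@ord_lt d) al}.

Definition col_set (d : nat) (al : seq nat) (t : ssyt_type d al) (j : nat) :
  {set 'I_d} := [set val t x | x : box al & box_col x == j].

(* Columns being strictly increasing, two of them differ if and only if their *)
(* sets of entries do.                                                        *)
Definition ssyt_lt (d : nat) (al : seq nat) : rel (ssyt_type d al) :=
  fun t u =>
  [exists j : 'I_(head 0%N al),
     [&& col_set t j != col_set u j,
         [forall k : 'I_(head 0%N al), (j < k)%N ==>
            (col_set t k == col_set u k)]
       & [exists e in col_set u j :\: col_set t j,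
            forall e' in (col_set t j :\: col_set u j)
                           :|: (col_set u j :\: col_set t j), (e' <= e)%N]]].

Definition weight (d : nat) (nu al : seq nat)
    (T : {ffun box nu -> ssyt_type d al}) : seq nat :=
  [seq (\sum_(x : box nu) #|[set y : box al | val (T x) y == b]|)%N
     | b <- enum 'I_d].

Definition eq_composition (a b : seq nat) : bool :=
  all (fun i => nth 0%N a i == nth 0%N b i) (iota 0 (maxn (size a) (size b))).

(** * Schur functors *)

Section SchurFunctor.
Variables (F : fieldType) (I : finType).
Implicit Types U V W : vectType F.

(* The tensor power of V with factors indexed by I; f stands for the tensor   *)
(* product over i of the f i-th vectors of the basis of V.                    *)
Definition tensor V : vectType F :=
  {ffun {ffun I -> 'I_(\dim {:V})} -> F^o}.

Definition coef V W (g : 'Hom(V, W)) (i : 'I_(\dim {:V}))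
    (j : 'I_(\dim {:W})) : F :=
  coord (vbasis {:W}) j (g (vbasis {:V})`_i).

Definition tensor_map_fun V W (g : 'Hom(V, W)) (t : tensor V) : tensor W :=
  [ffun h : {ffun I -> 'I_(\dim {:W})} =>
     \sum_(f : {ffun I -> 'I_(\dim {:V})})
        t f * \prod_(i : I) coef g (f i) (h i)].

Fact tensor_map_is_linear V W (g : 'Hom(V, W)) : linear (tensor_map_fun g).
Proof.
move=> a t u; apply/ffunP=> h; rewrite !ffunE scaler_sumr -big_split /=.
apply: eq_bigr => f _; rewrite !ffunE mulrDl; congr (_ + _).
by rewrite -mulrA.
Qed.
HB.instance Definition _ V W (g : 'Hom(V, W)) :=
  GRing.isLinear.Build F (tensor V) (tensor W) _ (tensor_map_fun g)
    (tensor_map_is_linear g).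

Definition tensor_map V W (g : 'Hom(V, W)) : 'Hom(tensor V, tensor W) :=
  linfun (tensor_map_fun g).

(* Place permutation: the factor at place i is moved to place s i.            *)
Definition place V (s : {perm I}) (t : tensor V) : tensor V :=
  [ffun f : {ffun I -> 'I_(\dim {:V})} => t [ffun i => f (s i)]].

Fact place_is_linear V (s : {perm I}) : linear (@place V s).
Proof. by move=> a t u; apply/ffunP=> h; rewrite !ffunE. Qed.
HB.instance Definition _ V (s : {perm I}) :=
  GRing.isLinear.Build F (tensor V) (tensor V) _ (@place V s)
    (place_is_linear s).

Lemma coef_id V i j : coef (\1%VF : 'End(V)) i j = (i == j)%:R.
Proof.
by rewrite /coef id_lfunE coord_free ?(basis_free (vbasisP _)) // eq_sym.
Qed.

Lemma coef_comp U V W (g : 'Hom(V, W)) (h : 'Hom(U, V)) i j :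
  coef (g \o h)%VF i j = \sum_k coef h i k * coef g k j.
Proof.
rewrite {1}/coef comp_lfunE.
rewrite {1}(coord_vbasis (memvf (h (vbasis {:U})`_i))) !linear_sum.
by apply: eq_bigr => k _; rewrite !linearZ.
Qed.

Lemma tensor_map_id V : tensor_map (\1%VF : 'End(V)) = \1%VF.
Proof.
apply/lfunP=> t; rewrite id_lfunE lfunE; apply/ffunP=> h; rewrite ffunE.
rewrite (bigD1 h) //= [X in _ + X]big1 ?addr0 => [|f].
  by rewrite big1 ?mulr1 // => i _; rewrite coef_id eqxx.
move=> /eqP neq_fh; case: (pickP (fun i => f i != h i)) => [i neqi|eqf].
  by rewrite (bigD1 i) //= coef_id (negPf neqi) mul0r mulr0.
by case: neq_fh; apply/ffunP=> i; apply/eqP/negbFE/eqf.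
Qed.

Lemma tensor_map_comp U V W (g : 'Hom(V, W)) (h : 'Hom(U, V)) :
  tensor_map (g \o h)%VF = (tensor_map g \o tensor_map h)%VF.
Proof.
apply/lfunP=> t; rewrite comp_lfunE !lfunE /=; apply/ffunP=> q; rewrite !ffunE.
under [RHS]eq_bigr => p _ do rewrite ffunE mulr_suml.
rewrite exchange_big /=; apply: eq_bigr => f _.
under eq_bigr => i _ do rewrite coef_comp.
rewrite bigA_distr_bigA mulr_sumr; apply: eq_bigr => p _.
by rewrite -mulrA -big_split.
Qed.

Lemma tensor_map_place V W (g : 'Hom(V, W)) s t :
  tensor_map g (place s t) = place s (tensor_map g t).
Proof.
rewrite !lfunE /=; apply/ffunP=> h; rewrite !ffunE.
pose comp (u : {perm I}) (f : {ffun I -> 'I_(\dim {:V})}) :=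
  [ffun i => f (u i)].
rewrite [RHS](reindex (comp s)) /=; last first.
  by exists (comp s^-1%g) => f _; apply/ffunP=> i; rewrite !ffunE ?permK ?permKV.
apply: eq_bigr => f _; rewrite !ffunE; congr (_ * _).
rewrite (reindex_inj (@perm_inj _ s)) /=.
by apply: eq_bigr => i _; rewrite !ffunE.
Qed.

End SchurFunctor.

Definition row_group (al : seq nat) : {set {perm box al}} :=
  [set s : {perm box al} | [forall x, box_row (s x) == box_row x]].

Definition col_group (al : seq nat) : {set {perm box al}} :=
  [set s : {perm box al} | [forall x, box_col (s x) == box_col x]].

Section YoungSymmetrizer.
Variables (F : fieldType) (al : seq nat).
Implicit Types U V W : vectType F.

Definition young_fun V (t : tensor (box al) V) : tensor (box al) V :=
  \sum_(s in row_group al) \sum_(u in col_group al)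
    (-1) ^+ odd_perm u *: place s (place u t).

Fact young_is_linear V : linear (@young_fun V).
Proof.
move=> a t u; rewrite /young_fun scaler_sumr -big_split; apply: eq_bigr => s _.
rewrite scaler_sumr -big_split; apply: eq_bigr => w _ /=.
by rewrite !linearP.
Qed.
HB.instance Definition _ V :=
  GRing.isLinear.Build F (tensor (box al) V) (tensor (box al) V) _
    (@young_fun V) (@young_is_linear V).

Definition young_symmetrizer V : 'End(tensor (box al) V) :=
  linfun (@young_fun V).

(* nabla^al(V) is the image of the Young symmetrizer, antisymmetrizing along  *)
(* columns and then symmetrizing along rows, on the tensor power of V indexed *)
(* by the boxes of al; it is used in characteristic 0 only.  For al = (r) the *)
(* image is Sym^r, and for al = (1^r) it is the r-th exterior power.          *)
Definition schur V : vectType F := subvs_of (limg (young_symmetrizer V)).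

Definition schur_map V W (g : 'Hom(V, W)) : 'Hom(schur V, schur W) :=
  linfun (vsproj (limg (young_symmetrizer W))
            \o tensor_map (box al) g \o vsval).

Lemma tensor_map_young V W (g : 'Hom(V, W)) t :
  tensor_map (box al) g (young_symmetrizer V t) =
  young_symmetrizer W (tensor_map (box al) g t).
Proof.
have youngE U (v : tensor (box al) U) : young_symmetrizer U v = young_fun v.
  by rewrite lfunE.
rewrite !youngE linear_sum; apply: eq_bigr => s _.
rewrite linear_sum; apply: eq_bigr => u _.
by rewrite linearZ /= !tensor_map_place.
Qed.

(* The projection in [schur_map] is applied to elements of the image only.    *)
Lemma schur_mapE V W (g : 'Hom(V, W)) (v : schur V) :
  vsval (schur_map g v) = tensor_map (box al) g (vsval v).
Proof.
rewrite lfunE /= vsprojK //; case/memv_imgP: (subvsP v) => t _ ->.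
by rewrite tensor_map_young memv_img ?memvf.
Qed.

Lemma schur_map_id V : schur_map (\1%VF : 'End(V)) = \1%VF.
Proof.
apply/lfunP=> v; apply: val_inj => /=.
by rewrite schur_mapE tensor_map_id !id_lfunE.
Qed.

Lemma schur_map_comp U V W (g : 'Hom(V, W)) (h : 'Hom(U, V)) :
  schur_map (g \o h)%VF = (schur_map g \o schur_map h)%VF.
Proof.
apply/lfunP=> v; apply: val_inj => /=.
by rewrite schur_mapE tensor_map_comp !comp_lfunE !schur_mapE.
Qed.

End YoungSymmetrizer.

(** * Representations of GL(E) *)

Section Representations.
Variables (F : fieldType) (E : vectType F).

Definition in_GL (g : 'End(E)) : bool := lker g == 0%VS.

(* Only the values of [rep_act] on GL(E) matter.                              *)
Record GLrep := GLRep {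
  rep_space :> vectType F;
  rep_act : 'End(E) -> 'End(rep_space);
  rep_act1 : rep_act \1%VF = \1%VF;
  rep_actM : forall g h, in_GL g -> in_GL h ->
    rep_act (g \o h)%VF = (rep_act g \o rep_act h)%VF }.

Definition natural_rep : GLrep :=
  @GLRep E id erefl (fun _ _ _ _ => erefl).

Fact schur_rep_act1 al (W : GLrep) :
  schur_map al (rep_act W \1%VF) = \1%VF.
Proof. by rewrite rep_act1 schur_map_id. Qed.

Fact schur_rep_actM al (W : GLrep) g h : in_GL g -> in_GL h ->
  schur_map al (rep_act W (g \o h)%VF) =
  (schur_map al (rep_act W g) \o schur_map al (rep_act W h))%VF.
Proof. by move=> gG hG; rewrite rep_actM // schur_map_comp. Qed.

Definition schur_rep (al : seq nat) (W : GLrep) : GLrep :=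
  @GLRep (schur al W) (fun g => schur_map al (rep_act W g))
    (schur_rep_act1 al W) (@schur_rep_actM al W).

Definition stable (W : GLrep) (U : {vspace W}) : Prop :=
  forall g, in_GL g -> (rep_act W g @: U <= U)%VS.

Definition irreducible (W : GLrep) (U : {vspace W}) : Prop :=
  [/\ U != 0%VS, stable U &
      forall U' : {vspace W}, stable U' -> (U' <= U)%VS ->
        U' = 0%VS \/ U' = U].

Definition iso_to_subrep (V W : GLrep) (U : {vspace W}) : Prop :=
  exists phi : 'Hom(V, W),
    [/\ lker phi = 0%VS, limg phi = U &
        forall g, in_GL g -> (phi \o rep_act V g = rep_act W g \o phi)%VF].

Definition irr_decomposition (W : GLrep) (k : nat) (U : 'I_k -> {vspace W}) :
    Prop :=
  [/\ forall i, irreducible (U i),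
      directv (\sum_(i < k) U i) &
      (\sum_(i < k) U i)%VS = fullv].

(* [W : V] = c.  Complete reducibility and the Krull-Schmidt theorem, which   *)
(* hold for polynomial representations over C, make c exist and be unique.    *)
Definition has_multiplicity (W V : GLrep) (c : nat) : Prop :=
  exists (k : nat) (U : 'I_k -> {vspace W}),
    irr_decomposition U /\ c = #|[set i | `[< iso_to_subrep V (U i) >]]|.

End Representations.

(* Main.v *)
Require Import Defs.
From HB Require Import structures.
From mathcomp Require Import all_boot all_order all_algebra all_fingroup.
From mathcomp Require Import boolp reals complex.
From mathcomp Require Import zify ring.

Set Implicit Arguments.
Unset Strict Implicit.
Unset Printing Implicit Defensive.

Import Order.TTheory GRing.Theory Num.Theory.
Local Open Scope ring_scope.

(** Put alpha = mu + N(1^r) and kappa = lambda + N(n^r).  The bound is obtained in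
three steps.

The multiplicity is at most the dimension of a weight space.  If kappa has
at most d parts, nabla^kappa(E) contains a nonzero vector of weight kappa:
the Young symmetrizer applied to the tensor with i-th basis vectors along
row i.  Each summand of the plethysm isomorphic to nabla^kappa(E) therefore
contributes one such vector, and these are independent, so the multiplicity is
at most the dimension of the kappa-weight space (lemma
[multiplicity_le_eigen]).  To see a weight space as an eigenspace of a single
matrix, the torus element with distinct primes on its diagonal is used: by
unique factorization its eigenvalues separate weights.  If kappa has more than d
parts then nabla^kappa(E) = 0.

The weight space is spanned by tableaux.  For any spanning family of V indexed
by a totally ordered set, the images under the Young symmetrizer of the pure
tensors attached to semistandard fillings span nabla^al(V)
([schur_spanning]); this is the straightening algorithm based on Garnir
relations.  Applied twice, first to the basis of E and then to the resulting
family indexed by semistandard tableaux, it gives a family of eigenvectors,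
indexed by semistandard tableaux of tableaux, that spans the plethysm; their
eigenvalues are read off from the weights.  Counting those of weight kappa yields
[multiplicity_le_ssyt], which is the required bound with N in place of L.

Finally the count for N is at most the count for L.  Let q = mu_{r+1}.  In a
tableau T of weight kappa, count the entries at most r.  An inner tableau of
shape alpha has at most mu_1 + ... + mu_r + Nr of them, and it has at most
mu_1 + ... + mu_(r-1) + (r-1)N + q + (N-L) - 1 of them unless its columns q+1, ..., q+N-L, which have height r, all consist of
1, ..., r: otherwise the entries of its row r exceed r from one of these columns
onwards.  The definition of L says that not even one inner tableau can fall
short ([initial_columns_of_weight]).  Deleting these N-L columns from every inner
tableau is thus injective; it preserves the order on inner tableaux because
the deleted columns agree everywhere, and it lowers the weight by
(N-L)(n^r) ([remove_columns_card]). *)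

(** * Pure tensors *)

Definition spanning (F : fieldType) (V : vectType F) (A : finType)
    (P : pred A) (v : A -> V) : Prop :=
  forall z : V, exists c : A -> F, z = \sum_(a | P a) c a *: v a.

Lemma mem_sum_lines (F : fieldType) (V : vectType F) (A : finType)
    (P : pred A) (v : A -> V) (z : V) :
  reflect (exists c : A -> F, z = \sum_(a | P a) c a *: v a)
    (z \in (\sum_(a | P a) <[v a]>)%VS).
Proof.
apply: (iffP idP) => [/memv_sumP[w w_in ->] | [c ->]]; last first.
  by apply: memv_sumr => a Pa; rewrite memvZ // memv_line.
have /boolp.choice [c Hc] : forall a, exists k, P a -> w a = k *: v a.
  move=> a; case Pa: (P a); last by exists 0.
  by have /vlineP[k ->] := w_in a Pa; exists k.
by exists c; apply: eq_bigr => a Pa; apply: Hc.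
Qed.

Section PureTensors.
Variables (F : fieldType) (I : finType).
Implicit Types V W : vectType F.

Definition pure V (w : I -> V) : tensor I V :=
  [ffun f : {ffun I -> 'I_(\dim {:V})} =>
     \prod_i coord (vbasis {:V}) (f i) (w i)].

Lemma pureE V (w : I -> V) f :
  pure w f = \prod_i coord (vbasis {:V}) (f i) (w i).
Proof. exact: ffunE. Qed.

Lemma eq_pure V (w w' : I -> V) : w =1 w' -> pure w = pure w'.
Proof.
by move=> eqw; apply/ffunP=> f; rewrite !ffunE; apply: eq_bigr => i _; rewrite eqw.
Qed.

Lemma place_pure V (s : {perm I}) (w : I -> V) :
  place s (pure w) = pure (w \o s^-1%g).
Proof.
apply/ffunP=> f; rewrite !ffunE.
rewrite [RHS](reindex_inj (@perm_inj _ s)) /=.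
by apply: eq_bigr => i _; rewrite ffunE permK.
Qed.

Lemma placeM V (s u : {perm I}) (t : tensor I V) :
  place s (place u t) = place (u * s)%g t.
Proof.
apply/ffunP=> f; rewrite !ffunE; congr (t _); apply/ffunP=> i.
by rewrite !ffunE permM.
Qed.

Lemma tensor_map_pure V W (g : 'Hom(V, W)) (w : I -> V) :
  tensor_map I g (pure w) = pure (g \o w).
Proof.
rewrite lfunE /=; apply/ffunP=> h; rewrite !ffunE.
under [LHS]eq_bigr => f _ do rewrite pureE -big_split /=.
rewrite -(bigA_distr_bigA (fun i k => coord (vbasis {:V}) k (w i) * coef g k (h i))).
apply: eq_bigr => i _ /=.
rewrite {2}(coord_vbasis (memvf (w i))) !linear_sum.
by apply: eq_bigr => k _; rewrite !linearZ.
Qed.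

(** Multilinearity: expanding each factor over the same family [v] produces one
pure tensor for each filling. *)
Lemma pure_sum V (A : finType) (c : I -> A -> F) (v : A -> V) :
  pure (fun i => \sum_a c i a *: v a) =
  \sum_(T : {ffun I -> A}) (\prod_i c i (T i)) *: pure (v \o T).
Proof.
apply/ffunP=> f; rewrite !ffunE sum_ffunE.
under eq_bigr => i _.
  rewrite linear_sum; under eq_bigr do rewrite linearZ; over.
rewrite bigA_distr_bigA; apply: eq_bigr => T _.
by rewrite big_split /= !ffunE.
Qed.

Lemma pure_scale V (c : I -> F) (w : I -> V) :
  pure (fun i => c i *: w i) = (\prod_i c i) *: pure w.
Proof.
apply/ffunP=> f; rewrite !ffunE.
under eq_bigr => i _ do rewrite linearZ.
by rewrite big_split.
Qed.

Lemma pure_basis V (h f : {ffun I -> 'I_(\dim {:V})}) :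
  pure (fun i => (vbasis {:V})`_(h i)) f = (f == h)%:R.
Proof.
rewrite ffunE; under eq_bigr => i _.
  rewrite coord_free ?(basis_free (vbasisP _)) //; over.
case: eqP => [-> | /eqP neq]; first by rewrite big1 // => i _; rewrite eqxx.
case: (pickP (fun i => f i != h i)) => [i ni | eqf].
  by rewrite (bigD1 i) //= eq_sym (negPf ni) mul0r.
by case/eqP: neq; apply/ffunP=> i; apply/eqP/negbFE/eqf.
Qed.

Lemma tensor_basis V (t : tensor I V) :
  t = \sum_h t h *: pure (fun i => (vbasis {:V})`_(h i)).
Proof.
apply/ffunP=> f; rewrite sum_ffunE (bigD1 f) //= big1 => [|h hf].
  by rewrite ffunE pure_basis eqxx addr0; exact: esym (mulr1 _).
by rewrite ffunE pure_basis eq_sym (negPf hf); exact: mulr0.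
Qed.

Lemma pure_spanning V (A : finType) (v : A -> V) :
  spanning predT v ->
  spanning predT (fun T : {ffun I -> A} => pure (v \o T)).
Proof.
move=> v_span t; apply/mem_sum_lines; rewrite (tensor_basis t).
apply: memv_suml => h _; rewrite memvZ //; apply/mem_sum_lines.
have /boolp.choice [c Hc] := fun i => v_span (vbasis {:V})`_(h i).
exists (fun T : {ffun I -> A} => \prod_i c i (T i)); rewrite -pure_sum.
by apply: eq_pure => i; apply: Hc.
Qed.

End PureTensors.

(** * Garnir relations *)

Section Young.
Variables (F : numFieldType) (al : seq nat).
Implicit Types V W : vectType F.

Lemma row_groupP (s : {perm box al}) :
  reflect (forall x, box_row (s x) = box_row x) (s \in row_group al).
Proof. by rewrite inE; apply: (iffP forallP) => H x; apply/eqP/H. Qed.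

Lemma col_groupP (s : {perm box al}) :
  reflect (forall x, box_col (s x) = box_col x) (s \in col_group al).
Proof. by rewrite inE; apply: (iffP forallP) => H x; apply/eqP/H. Qed.

(** The signed sum over the column group absorbs a column permutation up to its
sign. *)
Lemma young_place_col V (u : {perm box al}) (t : tensor (box al) V) :
  u \in col_group al ->
  young_fun (place u t) = (-1) ^+ odd_perm u *: young_fun t.
Proof.
move=> /col_groupP uC; rewrite /young_fun scaler_sumr; apply: eq_bigr => s _.
rewrite scaler_sumr [RHS](reindex_inj (mulgI u)) /=.
apply: eq_big => [w | w _].
  apply/col_groupP/col_groupP => H x.
    by rewrite permM H uC.
  by rewrite -[x](permKV u) -permM H uC.
rewrite scalerA odd_permM signr_addb mulrA -signr_addb addbb mul1r.
by rewrite [place w _]placeM.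
Qed.

Lemma eq_opp0 V (z : V) : z = - z -> z = 0.
Proof.
move=> H; have : 2%:R *: z == 0 by rewrite scaler_nat mulr2n {2}H subrr.
by rewrite scaler_eq0 pnatr_eq0 /= => /eqP.
Qed.

(** Fix [u] in the column group.  Two boxes of [Z] are sent by [u] to one row, so
their transposition [tau] is conjugate under [u] to an element of the row group.
Multiplying by [tau] changes the sign of the signed sum over the permutations of
[Z], whereas its conjugate is absorbed by the row sum: the contribution of [u]
equals its own opposite. *)
Lemma garnir V (Z : {set box al}) (t : tensor (box al) V) :
  (forall u, u \in col_group al ->
     exists x y, [/\ x \in Z, y \in Z, x != y & box_row (u x) = box_row (u y)]) ->
  \sum_(s | perm_on Z s) (-1) ^+ odd_perm s *: young_fun (place s t) = 0.
Proof.
move=> coll.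
under eq_bigr => s _.
  rewrite /young_fun exchange_big /= scaler_sumr.
  under eq_bigr => u _ do rewrite -scaler_sumr scalerA mulrC -scalerA.
  over.
rewrite exchange_big big1 //= => u uC.
rewrite -scaler_sumr; set S := (X in _ *: X); suff -> : S = 0 by rewrite scaler0.
have [x [y [xZ yZ xy rxy]]] := coll u uC.
apply: eq_opp0; rewrite {1}/S (reindex_inj (mulIg (tperm x y))) /= -sumrN.
have onT : perm_on Z (tperm x y).
  apply/subsetP=> z; rewrite !inE; apply: contraR => zZ.
  by rewrite tpermD // (contraTneq _ zZ) // => <-; rewrite ?xZ ?yZ.
apply: eq_big => [s | s _].
  apply/idP/idP => H; last exact: perm_onM.
  by rewrite -[s](mulgK (tperm x y)) tpermV perm_onM.
rewrite odd_permM odd_tperm xy addbT signrN scaleNr; congr (- (_ *: _)).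
rewrite [LHS](reindex_inj (mulgI (tperm (u x) (u y)))) /=.
have Tr z : box_row (tperm (u x) (u y) z) = box_row z.
  by case: tpermP => [->|->|].
apply: eq_big => [w | w _].
  by apply/row_groupP/row_groupP => H z; have := H (tperm (u x) (u y) z);
     rewrite ?permM ?tpermK ?Tr // => ->; rewrite ?Tr.
rewrite !placeM; congr (place _ t).
by rewrite -tpermJ conjgE !mulgA mulgK -!mulgA (mulgA _ _ (u * w)%g) tperm2 mul1g.
Qed.
End Young.

(** * Boxes of a Young diagram *)

Section Boxes.
Local Open Scope nat_scope.
Variable al : seq nat.
Implicit Types x y : box al.

Lemma box_eq x y : box_row x = box_row y -> box_col x = box_col y -> x = y.
Proof.
case: x y => [i j] [i' j']; rewrite /box_row /box_col /= => /val_inj eqi.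
by case: _ / eqi in j' * => /val_inj ->.
Qed.

Lemma box_col_lt x : box_col x < nth 0 al (box_row x).
Proof. by case: x => i j; apply: ltn_ord. Qed.

Fact box_at_row i j : j < nth 0 al i -> i < size al.
Proof.
move=> lt_j; rewrite ltnNge.
by apply: contraTN lt_j => /(nth_default 0) ->.
Qed.

Definition box_at i j (lt_j : j < nth 0 al i) : box al :=
  Tagged (fun i : 'I_(size al) => 'I_(nth 0 al i))
    (i := Ordinal (box_at_row lt_j)) (Ordinal lt_j).

Lemma exists_box i j : j < nth 0 al i ->
  exists x : box al, box_row x = i /\ box_col x = j.
Proof. by move=> lt_j; exists (box_at lt_j). Qed.

Lemma nth_partition i i' : sorted geq al -> i <= i' -> nth 0 al i' <= nth 0 al i.
Proof.
move=> al_sorted le_i; case: (ltnP i' (size al)) => [lt_i'|]; last first.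
  by move=> /(nth_default 0) ->.
apply: (sorted_leq_nth _ _ 0 al_sorted); rewrite ?inE //.
- by move=> a b c /= ba cb; apply: leq_trans ba.
- exact: leqnn.
- exact: leq_ltn_trans lt_i'.
Qed.

Lemma card_row_left i c :
  #|[set x : box al | (box_row x == i) && (box_col x < c)]| = minn c (nth 0 al i).
Proof.
set S := [set x | _]; rewrite cardE -(size_map (@box_col al)).
rewrite -[RHS](size_iota 0); apply/perm_size/uniq_perm; rewrite ?iota_uniq //.
  rewrite map_inj_in_uniq ?enum_uniq // => x y.
  rewrite !mem_enum !inE => /andP[/eqP rx _] /andP[/eqP ry _] cxy.
  by apply: box_eq; rewrite // rx ry.
move=> j; rewrite mem_iota /= add0n leq_min.
apply/mapP/andP => [[x] | [lt_c lt_j]].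
  rewrite mem_enum inE => /andP[/eqP rx cx] ->; split=> //.
  by have := box_col_lt x; rewrite rx.
have [x [rx cx]] := exists_box lt_j; exists x => //.
by rewrite mem_enum inE rx cx eqxx.
Qed.

Lemma card_row i : #|[set x : box al | box_row x == i]| = nth 0 al i.
Proof.
rewrite -[RHS]minnn -card_row_left; apply: eq_card => x; rewrite !inE.
by case: eqP => //= <-; rewrite box_col_lt.
Qed.

Lemma card_rows_above p :
  #|[set x : box al | box_row x < p]| = \sum_(0 <= i < p) nth 0 al i.
Proof.
elim: p => [|p IHp]; first by rewrite big_nil; apply: eq_card0 => x; rewrite !inE.
rewrite big_nat_recr //= -IHp -card_row -cardsUI [X in _ = _ + X]eq_card0 ?addn0.
  by apply: eq_card => x; rewrite !inE ltnS leq_eqVlt orbC.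
by move=> x; rewrite !inE; case: ltngtP.
Qed.

End Boxes.

(** * Straightening *)

Lemma measure_up_ind (T : finType) (f : T -> nat) (P : T -> Prop) :
  (forall x, (forall y, (f x < f y)%N -> P y) -> P x) -> forall x, P x.
Proof.
move=> step x; have [b] := ubnP (\max_y f y - f x)%N.
elim: b x => // b IHb x lt_b; apply: step => y lt_xy; apply: IHb.
have := leq_bigmax (F := f) y; have := leq_bigmax (F := f) x; lia.
Qed.

Section Straightening.
Variables (F : numFieldType) (A : finType) (lt : rel A) (rk : A -> nat).
Hypothesis lt_rk : forall a b, lt a b -> (rk a < rk b)%N.
Hypothesis lt_total : forall a b, a != b -> lt a b || lt b a.
Variables (al : seq nat) (V : vectType F) (v : A -> V).
Hypothesis al_sorted : sorted geq al.

Notation filling := {ffun box al -> A}.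
Implicit Types T S : filling.

(** The vectors to be straightened: those indexed by all fillings span the Schur
functor, and each will be rewritten in terms of semistandard ones. *)
Definition young_tensor (T : filling) : tensor (box al) V :=
  young_fun (pure (v \o T)).

Definition permute (s : {perm box al}) (T : filling) : filling :=
  [ffun x => T (s^-1%g x)].

Lemma young_permute s T :
  young_tensor (permute s T) = young_fun (place s (pure (v \o T))).
Proof.
rewrite place_pure; congr young_fun; apply: eq_pure => x.
by rewrite /= ffunE.
Qed.

Lemma young_permute_col s T : s \in col_group al ->
  young_tensor (permute s T) = (-1) ^+ odd_perm s *: young_tensor T.
Proof. by move=> sC; rewrite young_permute young_place_col. Qed.

(** Straightening terminates because it increases a potential.  A Garnir relation
moves larger entries to the right, which increases [col_potential]; sorting a
column keeps [col_potential] and moves larger entries down, which increases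
[row_potential].  The factor in [potential] makes the comparison
lexicographic. *)
Definition col_potential (T : filling) : nat := (\sum_x box_col x * rk (T x))%N.
Definition row_potential (T : filling) : nat := (\sum_x box_row x * rk (T x))%N.
Definition potential (T : filling) : nat :=
  (col_potential T * (\max_S row_potential S).+1 + row_potential T)%N.

Lemma potential_col T S :
  (col_potential T < col_potential S)%N -> (potential T < potential S)%N.
Proof. by rewrite /potential; have := leq_bigmax (F := row_potential) T; nia. Qed.

Lemma tperm_col x y : box_col x = box_col y -> tperm x y \in col_group al.
Proof. by move=> cxy; apply/col_groupP => z; case: tpermP => [->|->|]. Qed.

Lemma young_col_repeat T x y : x != y -> box_col x = box_col y ->
  T x = T y -> young_tensor T = 0.
Proof.
move=> xy cxy Txy; apply: eq_opp0.
rewrite -[RHS]scaleN1r.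
have -> : -1 = (-1) ^+ odd_perm (tperm x y) :> F by rewrite odd_tperm xy.
rewrite -young_permute_col ?tperm_col //; congr young_tensor.
by apply/ffunP=> z; rewrite ffunE tpermV; case: tpermP => [->|->|].
Qed.

Lemma col_potential_permute s T :
  col_potential (permute s T) = (\sum_x box_col (s x) * rk (T x))%N.
Proof.
rewrite /col_potential (reindex_inj (@perm_inj _ s)) /=.
by apply: eq_bigr => x _; rewrite ffunE permK.
Qed.

Lemma row_potential_permute s T :
  row_potential (permute s T) = (\sum_x box_row (s x) * rk (T x))%N.
Proof.
rewrite /row_potential (reindex_inj (@perm_inj _ s)) /=.
by apply: eq_bigr => x _; rewrite ffunE permK.
Qed.

Lemma potential_swap T x y : box_col x = box_col y ->
  (box_row x < box_row y)%N -> (rk (T y) < rk (T x))%N ->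
  (potential T < potential (permute (tperm x y) T))%N.
Proof.
move=> cxy rxy rkyx; rewrite /potential.
have -> : col_potential (permute (tperm x y) T) = col_potential T.
  rewrite col_potential_permute; apply: eq_bigr => z _; congr (_ * _)%N.
  by case: tpermP => [->|->|].
rewrite ltn_add2l row_potential_permute /row_potential.
have yx : y != x by apply: contraTneq rxy => ->; rewrite ltnn.
rewrite (bigD1 x) //= (bigD1 y) //= [X in (_ < X)%N](bigD1 x) //=.
rewrite [X in (_ < _ + X)%N](bigD1 y) //= tpermL tpermR.
rewrite [X in (_ < _ + (_ + X))%N](eq_bigr (fun z => box_row z * rk (T z))%N).
  rewrite !addnA ltn_add2r; move: rxy rkyx.
  by move: (box_row x) (box_row y) (rk (T x)) (rk (T y)) => a b c e; nia.
by move=> z /andP[zx zy]; rewrite tpermD // eq_sym.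
Qed.

(** The Garnir step at a descent [T x > T y] in a row, for a filling with strictly
increasing columns.  [X] is the part of the column of [x] weakly below [x], and
[Y] the part of the column of [y] weakly above [y], so all entries in [X] exceed
all entries in [Y]. *)
Section GarnirStep.
Variables (T : filling) (x y : box al).
Hypothesis row_xy : box_row x = box_row y.
Hypothesis col_xy : (box_col x < box_col y)%N.
Hypothesis rk_xy : (rk (T y) < rk (T x))%N.
Hypothesis T_col : forall z w, box_col z = box_col w ->
  (box_row z < box_row w)%N -> (rk (T z) < rk (T w))%N.

Let X := [set z : box al | (box_col z == box_col x) && (box_row x <= box_row z)%N].
Let Y := [set z : box al | (box_col z == box_col y) && (box_row z <= box_row y)%N].
Let Z := X :|: Y.

(** Together [X] and [Y] have one box more than the column of [x] has rows, as
they both meet the row of [x]; a column permutation keeps [Z] inside the rows of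
that column. *)
Lemma garnir_collision u : u \in col_group al ->
  exists z w, [/\ z \in Z, w \in Z, z != w & box_row (u z) = box_row (u w)].
Proof.
move=> /col_groupP uC.
case: (boolP [exists z in Z, exists w in Z,
               (z != w) && (box_row (u z) == box_row (u w))]).
  move=> /exists_inP[z zZ /exists_inP[w wZ /andP[zw /eqP rzw]]].
  by exists z, w.
move=> nocoll; exfalso.
have inj_u : {in Z &, injective (fun z => tag (u z))}.
  move=> z w zZ wZ /(congr1 val) eqr; apply: contraNeq nocoll => zw.
  by apply/exists_inP; exists z => //; apply/exists_inP; exists w => //; rewrite zw; apply/eqP.
pose R := [set i : 'I_(size al) | (box_col x < nth 0%N al i)%N].
have ZR : [set tag (u z) | z in Z] \subset R.
  apply/subsetP=> _ /imsetP[z zZ ->]; rewrite inE.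
  apply: leq_ltn_trans (box_col_lt (u z)); rewrite uC.
  by move: zZ; rewrite !inE => /orP[] /andP[/eqP-> _] //; apply: ltnW.
have /= := subset_leq_card ZR; rewrite card_in_imset //.
have disj : [disjoint X & Y].
  rewrite -setI_eq0; apply/eqP/setP=> z; rewrite !inE.
  apply/negP=> /andP[/andP[/eqP-> _] /andP[/eqP eqc _]].
  by move: col_xy; rewrite eqc ltnn.
have tag_inj (c : nat) (W : {set box al}) : (forall z, z \in W -> box_col z = c) ->
    {in W &, injective (@tag _ (fun i : 'I_(size al) => 'I_(nth 0%N al i)))}.
  move=> Wc z w zW wW /(congr1 val) eqr; apply: box_eq => //.
  by rewrite !Wc.
have -> : #|Z| = (#|X| + #|Y|)%N.
  by rewrite -cardsUI (_ : X :&: Y = set0) ?cards0 ?addn0 //; apply/eqP; rewrite setI_eq0.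
rewrite -(card_in_imset (tag_inj (box_col x) X _)); last first.
  by move=> z; rewrite inE => /andP[/eqP].
rewrite -(card_in_imset (tag_inj (box_col y) Y _)); last first.
  by move=> z; rewrite inE => /andP[/eqP].
(* The rows met by X and by Y cover R and have the row of x in common. *)
rewrite -cardsUI => le_card.
suff: (#|R| < #|R|)%N by rewrite ltnn.
apply: leq_trans le_card; rewrite -addn1; apply: leq_add.
  apply/subset_leq_card/subsetP => i; rewrite inE => lt_i; rewrite inE.
  case: (leqP (box_row x) i) => [le_i | /ltnW le_i].
    have [z [rz cz]] := exists_box lt_i; apply/orP; left.
    by apply/imsetP; exists z; [rewrite inE cz rz eqxx | apply: val_inj].
  have lt_i' : (box_col y < nth 0%N al i)%N.
    by apply: leq_trans (box_col_lt y) _; apply: nth_partition; rewrite // -row_xy.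
  have [z [rz cz]] := exists_box lt_i'; apply/orP; right.
  apply/imsetP; exists z; last exact: val_inj.
  by rewrite inE cz rz eqxx -row_xy.
rewrite card_gt0; apply/set0Pn; exists (tag x); rewrite inE.
apply/andP; split; apply/imsetP.
  by exists x; rewrite // inE eqxx /=.
by exists y; [rewrite inE eqxx /= | apply: val_inj].
Qed.

(** A permutation of [Z] that moves some box to another column exchanges entries
of [X] and [Y], so larger entries go right. *)
Lemma garnir_potential s : perm_on Z s -> s \notin col_group al ->
  (potential T < potential (permute s T))%N.
Proof.
move=> sZ sC; apply: potential_col; rewrite col_potential_permute.
(* The sum of D is 0, so the weights in the sum of D z times the rank of T z may
   be shifted by a constant.  Half-way between the rank of T y and the next
   integer, the shifted weight is positive on X and negative on Y, like D. *)
pose D z : int := (box_col (s z))%:Z - (box_col z)%:Z.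
pose E z : int := 2 * (rk (T z))%:Z - 2 * (rk (T y))%:Z - 1.
have colZ z : z \in Z -> (box_col x <= box_col z <= box_col y)%N.
  by rewrite !inE => /orP[] /andP[/eqP-> _]; rewrite leqnn ltnW.
have DE z : 0 <= D z * E z ?= iff (box_col (s z) == box_col z).
  case: (boolP (z \in Z)) => [zZ|]; last first.
    by move=> zZ; rewrite /D (out_perm sZ zZ) subrr mul0r eqxx; apply/leifP; rewrite eqxx.
  have /colZ := zZ; rewrite -(perm_closed _ sZ) in zZ; have := colZ _ zZ.
  rewrite (perm_closed _ sZ) !inE in zZ; move=> colsz colz.
  have [rkz|rkz] : (rk (T y) < rk (T z) /\ box_col z = box_col x \/
                    rk (T z) <= rk (T y) /\ box_col z = box_col y)%N.
    case/orP: zZ => /andP[/eqP cz rz]; [left | right]; split=> //.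
      move: rz; rewrite leq_eqVlt => /orP[/eqP rz|rz].
        by rewrite (_ : z = x) //; apply: box_eq.
      by apply: leq_trans rk_xy (ltnW (T_col _ _)).
    move: rz; rewrite leq_eqVlt => /orP[/eqP rz|rz].
      by rewrite (_ : z = y) //; apply: box_eq.
    by apply: ltnW (T_col _ _).
  - apply/leifP; rewrite /D /E; case: eqP => [->|/eqP]; first by rewrite subrr mul0r.
    by case: rkz => ? ? ?; nia.
  - apply/leifP; rewrite /D /E; case: eqP => [->|/eqP]; first by rewrite subrr mul0r.
    by case: rkz => ? ? ?; nia.
have : 0 < \sum_z D z * E z.
  rewrite lt_def; apply/andP; split; last by apply: sumr_ge0 => z _; case: (DE z).
  apply: contra sC => sum0; apply/col_groupP => z; apply/eqP.
  have [_ <-] := DE z; rewrite eq_sym.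
  by move: sum0; rewrite psumr_eq0 => [/allP/(_ z (mem_index_enum _))|w _] //; case: (DE w).
have sumD : \sum_z D z = 0.
  by rewrite sumrB [X in _ - X](reindex_inj (@perm_inj _ s)) subrr.
have -> : \sum_z D z * E z =
  2 * \sum_z D z * (rk (T z))%:Z - (2 * (rk (T y))%:Z + 1) * \sum_z D z.
  by rewrite !mulr_sumr -sumrB; apply: eq_bigr => z _; rewrite /E; ring.
rewrite sumD mulr0 subr0.
have -> : \sum_z D z * (rk (T z))%:Z =
  (\sum_x box_col (s x) * rk (T x))%N%:Z - (col_potential T)%:Z.
  rewrite /col_potential !(big_morph Posz PoszD erefl) -sumrB.
  by apply: eq_bigr => z _; rewrite mulrBl !PoszM.
by lia.
Qed.

(** In the Garnir relation the permutations preserving columns each contribute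
[young_tensor T] itself, with sign + after cancellation; their number is
invertible, so the other terms, all of higher potential, determine it. *)
Lemma garnir_straighten (U : {vspace tensor (box al) V}) :
  (forall S, (potential T < potential S)%N -> young_tensor S \in U) ->
  young_tensor T \in U.
Proof.
move=> higher; have := garnir (pure (v \o T)) garnir_collision.
rewrite (bigID [in col_group al]) /=.
under eq_bigr => s /andP[sZ sC].
  rewrite young_place_col // scalerA -signr_addb addbb scale1r; over.
rewrite sumr_const => /eqP; rewrite addr_eq0 -scaler_nat => /eqP eqT.
have : #|[pred s | perm_on Z s & s \in col_group al]|%:R != 0 :> F.
  rewrite pnatr_eq0 -lt0n; apply/card_gt0P; exists 1%g.
  rewrite inE perm_on1; apply/col_groupP => z; by rewrite perm1.
move=> card_n0; rewrite -[young_tensor T](scalerK card_n0) memvZ //.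
rewrite eqT memvN; apply: memv_suml => s /andP[sZ sC].
by rewrite memvZ // -young_permute higher // garnir_potential.
Qed.

End GarnirStep.

Lemma young_tensor_straighten T :
  young_tensor T \in (\sum_(S in SSYT lt al) <[young_tensor S]>)%VS.
Proof.
set U := (\sum_(S in _) _)%VS.
elim/(measure_up_ind (f := potential)): T => T higher.
case: (boolP (T \in SSYT lt al)) => [Tss | ].
  by apply: (subvP (sumv_sup T Tss (subvv _))); rewrite memv_line.
have [colP | [z [w [czw rzw nlt]]]] : (forall z w, box_col z = box_col w ->
    (box_row z < box_row w)%N -> lt (T z) (T w)) \/
  exists z w, [/\ box_col z = box_col w, (box_row z < box_row w)%N &
     ~~ lt (T z) (T w)].
- case: (boolP [forall z, forall w, (box_col z == box_col w) &&
         (box_row z < box_row w)%N ==> lt (T z) (T w)]) => [/forallP H|].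
    by left=> z w czw rzw; have /forallP/(_ w)/implyP := H z; apply; rewrite czw eqxx.
  rewrite negb_forall => /existsP[z]; rewrite negb_forall => /existsP[w].
  by rewrite negb_imply => /andP[/andP[/eqP ? ?] ?]; right; exists z, w.
- rewrite inE negb_and => /orP[]; last first.
    rewrite negb_forall => /existsP[z]; rewrite negb_forall => /existsP[w].
    rewrite negb_imply => /andP[/andP[/eqP czw rzw]].
    by rewrite colP.
  rewrite negb_forall => /existsP[x]; rewrite negb_forall => /existsP[y].
  rewrite negb_imply negb_or => /andP[/andP[/eqP rxy cxy] /andP[Txy nlt]].
  have := lt_total Txy; rewrite (negPf nlt) => /lt_rk rk_xy.
  apply: (garnir_straighten rxy cxy rk_xy) => // z w czw rzw.
  exact/lt_rk/colP.
- move=> _; case: (eqVneq (T z) (T w)) => [Tzw | /lt_total].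
    rewrite (young_col_repeat _ czw Tzw) ?mem0v //.
    by apply: contraTneq rzw => ->; rewrite ltnn.
  rewrite (negPf nlt) => /lt_rk rk_wz.
  have := higher _ (potential_swap czw rzw rk_wz).
  by rewrite young_permute_col ?tperm_col // rpredZsign.
Qed.

Hypothesis v_spanning : spanning predT v.

Definition schur_vector T : schur al V :=
  vsproj (limg (young_symmetrizer al V)) (young_tensor T).

Lemma schur_vectorK T : vsval (schur_vector T) = young_tensor T.
Proof.
apply: vsprojK; rewrite /young_tensor.
have -> : young_fun (pure (v \o T)) = young_symmetrizer al V (pure (v \o T)).
  by rewrite lfunE.
by rewrite memv_img ?memvf.
Qed.

(** The straightening theorem: semistandard fillings have no Garnir step and no
column sorting step left, and every step increases the bounded [potential]. *)
Lemma schur_spanning : spanning [in SSYT lt al] schur_vector.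
Proof.
move=> z; case/memv_imgP: (subvsP z) => t _ zt.
suff /mem_sum_lines[c Hc] : vsval z \in (\sum_(S in SSYT lt al) <[young_tensor S]>)%VS.
  exists c; apply: val_inj; rewrite /= Hc linear_sum /=.
  by apply: eq_bigr => S _; rewrite schur_vectorK.
rewrite zt; have [c ->] := pure_spanning v_spanning t.
rewrite lfunE /= linear_sum; apply: memv_suml => S _.
by rewrite linearZ /= memvZ // young_tensor_straighten.
Qed.

End Straightening.

(** * The order on semistandard tableaux *)

Section BinaryRank.
Local Open Scope nat_scope.
Variables (I : finType) (code : I -> nat).
Hypothesis code_inj : injective code.

Lemma sum_pow2_lt (P : pred I) (k : nat) :
  \sum_(i | P i && (code i < k)) 2 ^ code i < 2 ^ k.
Proof.
elim: k => [|k IHk]; first by rewrite big_pred0 // => i; rewrite ltn0 andbF.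
rewrite (bigID (fun i => code i < k)) /= expnS mul2n -addnn -addSn leq_add //.
  by rewrite (eq_bigl (fun i => P i && (code i < k))) // => i; lia.
case: (pickP (fun i => code i == k)) => [i /eqP ci | none]; last first.
  rewrite big_pred0 // => i; have := none i; lia.
apply: (@leq_trans (\sum_(j | j == i) 2 ^ code j)); last by rewrite big_pred1_eq ci.
rewrite [X in _ <= X](bigID (fun j => P j && (code j < k.+1) && ~~ (code j < k))) /=.
apply: leq_trans (leq_addr _ _); rewrite leq_eqVlt; apply/orP; left; apply/eqP.
apply: eq_bigl => j; case: (eqVneq j i) => //= ji.
have : code j != code i by rewrite (inj_eq code_inj).
by rewrite ci; lia.
Qed.

(** Binary numbers are compared at their highest differing digit. *)
Lemma sum_pow2_ltn (A B : {set I}) (i : I) : i \in B -> i \notin A ->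
  (forall j, code i < code j -> (j \in A) = (j \in B)) ->
  \sum_(j in A) 2 ^ code j < \sum_(j in B) 2 ^ code j.
Proof.
move=> iB iA eqAB.
rewrite (bigID (fun j => code j < code i)) [X in _ < X](bigID (fun j => code j < code i)) /=.
have := sum_pow2_lt [in A] (code i); set S := \sum_(_ | _) _ => lt_S.
rewrite [X in _ < _ + X](bigD1 i) ?iB ?ltnn //=.
set S' := \sum_(_ | _) _; set S'' := \sum_(_ | _ && ~~ _) _.
suff -> : S' = S'' by lia.
apply: eq_bigl => j; case: (eqVneq j i) => [-> | ji]; first by rewrite (negPf iA) andbF.
rewrite andbT -leqNgt [code i <= _]leq_eqVlt (inj_eq code_inj) eq_sym (negPf ji) /=.
by case: (boolP (code i < code j)) => [/eqAB-> | ]; rewrite ?andbF.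
Qed.
End BinaryRank.

Section TableauOrder.
Variables (d : nat) (al : seq nat).
Implicit Types t u : ssyt_type d al.

Lemma ssyt_row t x y : box_row x = box_row y -> (box_col x <= box_col y)%N ->
  (val t x <= val t y)%N.
Proof.
move=> rxy; rewrite leq_eqVlt => /orP[/eqP cxy|cxy]; first by rewrite (box_eq rxy cxy).
have := valP t; rewrite inE => /andP[/forallP/(_ x)/forallP/(_ y)/implyP H _].
by move: H; rewrite rxy eqxx cxy => /(_ isT)/orP[/eqP->|/ltnW].
Qed.

Lemma ssyt_col t x y : box_col x = box_col y -> (box_row x < box_row y)%N ->
  (val t x < val t y)%N.
Proof.
move=> cxy rxy.
have := valP t; rewrite inE => /andP[_ /forallP/(_ x)/forallP/(_ y)/implyP H].
by apply: H; rewrite cxy eqxx rxy.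
Qed.

Lemma col_setP t j e :
  reflect (exists2 x : box al, box_col x = j & val t x = e) (e \in col_set t j).
Proof.
apply: (iffP imsetP) => [[x] | [x cx <-]].
  by rewrite inE => /eqP cx ->; exists x.
by exists x; rewrite // inE cx.
Qed.

(** Columns are compared from the top: at the first row where two columns with the
same entries differ, the smaller of the two entries cannot occur in the other
column. *)
Lemma col_set_inj t u : (forall x : box al, col_set t (box_col x) = col_set u (box_col x)) ->
  t = u.
Proof.
move=> eqc; apply: val_inj; apply/ffunP=> x.
have [b] := ubnP (box_row x); elim: b x => // b IHb x lt_b; apply: val_inj => /=.
wlog : t u eqc IHb / (val t x <= val u x)%N.
  move=> W; case: (leqP (val t x) (val u x)) => [|/ltnW] le_x; first exact: W.
  by symmetry; by apply: W => // y yb; rewrite IHb.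
rewrite leq_eqVlt => /orP[/eqP // | lt_x].
have : val t x \in col_set u (box_col x).
  by rewrite -eqc; apply/col_setP; exists x.
case/col_setP => y cy uy; case: (ltnP (box_row y) (box_row x)) => rxy.
  have := ssyt_col t cy rxy; rewrite -uy -IHb ?ltnn //.
  by apply: leq_trans rxy _.
move: rxy; rewrite leq_eqVlt => /orP[/eqP rxy | rxy].
  by move: lt_x; rewrite -uy (box_eq rxy (esym cy)) ltnn.
by have := ssyt_col u (esym cy) rxy; rewrite uy ltnNge ltnW.
Qed.

(** A rank function for [ssyt_lt]: the entry [e] in column [j] is the binary digit
at position [j * d + e], so that comparing numbers compares columns from the
right, and columns from their greatest entry. *)
Definition ssyt_code (p : 'I_(head 0%N al) * 'I_d) : nat := (p.1 * d + p.2)%N.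

Definition entry_set t : {set 'I_(head 0%N al) * 'I_d} :=
  [set p : 'I_(head 0%N al) * 'I_d | p.2 \in col_set t p.1].

Definition ssyt_rank t : nat := (\sum_(p in entry_set t) 2 ^ ssyt_code p)%N.

Lemma ssyt_code_lt (p q : 'I_(head 0%N al) * 'I_d) :
  (ssyt_code p < ssyt_code q)%N =
  (p.1 < q.1)%N || ((p.1 == q.1 :> nat) && (p.2 < q.2)%N).
Proof.
case: p q => [j e] [k f]; rewrite /ssyt_code /=.
have := ltn_ord e; have := ltn_ord f; move: (e : nat) (f : nat) => a b.
by case: (ltngtP j k); nia.
Qed.

Lemma ssyt_code_inj : injective ssyt_code.
Proof.
move=> p q eqc; have := ssyt_code_lt p q; have := ssyt_code_lt q p.
rewrite eqc ltnn => /esym/negbT + /esym/negbT.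
by case: p q {eqc} => [j e] [k f] /= ? ?; congr (_, _); apply: val_inj => /=; lia.
Qed.

Lemma ssyt_lt_rank t u : ssyt_lt t u -> (ssyt_rank t < ssyt_rank u)%N.
Proof.
case/existsP => j /and3P[_ /forallP above /exists_inP[e e_u /forall_inP emax]].
apply: (sum_pow2_ltn ssyt_code_inj (i := (j, e))).
- by move: e_u; rewrite !inE /= => /andP[].
- by move: e_u; rewrite !inE /= => /andP[].
case=> k f; rewrite ssyt_code_lt /= !inE /= => /orP[jk | /andP[/eqP/val_inj <- ef]].
  by have /implyP/(_ jk)/eqP -> := above k.
apply/idP/idP => fP; apply: contraLR ef => fN; rewrite -leqNgt; apply: emax.
  by rewrite !inE fP fN.
by rewrite !inE fP fN orbT.
Qed.

Hypothesis al_sorted : sorted geq al.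

Lemma box_col_head (x : box al) : (box_col x < head 0%N al)%N.
Proof. by rewrite -nth0; apply: (leq_trans (box_col_lt x)); apply: nth_partition. Qed.

Lemma ssyt_lt_total t u : t != u -> ssyt_lt t u || ssyt_lt u t.
Proof.
move=> tu; pose D := [pred j : 'I_(head 0%N al) | col_set t j != col_set u j].
have [j Dj jmax] : exists2 j, D j & forall k, D k -> (k <= j)%N.
  case: (pickP D) => [j Dj | none].
    by case: (@arg_maxnP _ j D val Dj) => k Dk kmax; exists k.
  case/eqP: tu; apply: col_set_inj => x.
  by apply/eqP; have := none (Ordinal (box_col_head x)); rewrite /= => /negbFE.
rewrite /D /= in Dj.
have above : [forall k : 'I_(head 0%N al), (j < k)%N ==> (col_set t k == col_set u k)].
  apply/forallP=> k; apply/implyP; rewrite ltnNge; apply: contraR => Dk.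
  exact: jmax.
pose B := (col_set t j :\: col_set u j) :|: (col_set u j :\: col_set t j).
have [e eB emax] : exists2 e, e \in B & forall e', e' \in B -> (e' <= e)%N.
  have [e0 e0B] : exists e, e \in B.
    apply/set0Pn; apply: contraNneq Dj => /eqP; rewrite setU_eq0 !setD_eq0.
    by rewrite -eqEsubset.
  by case: (@arg_maxnP _ e0 [in B] val e0B) => e eB emax; exists e.
have := eB; rewrite inE => /orP[e_t | e_u]; apply/orP; [right | left].
  apply/existsP; exists j; rewrite eq_sym Dj /=; apply/andP; split.
    by apply/forallP=> k; rewrite eq_sym; apply: (forallP above).
  apply/existsP; exists e; rewrite e_t; apply/forallP=> e'; apply/implyP => e'B.
  by apply: emax; rewrite /B setUC.
apply/existsP; exists j; rewrite Dj above /=.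
by apply/existsP; exists e; rewrite e_u; apply/forallP=> e'; apply/implyP; apply: emax.
Qed.

Lemma ssyt_col_growth t x y : box_col x = box_col y ->
  (box_row x <= box_row y)%N -> (val t x + (box_row y - box_row x) <= val t y)%N.
Proof.
move=> cxy; move k_def: (box_row y - box_row x)%N => k.
elim: k y cxy k_def => [|k IHk] y cxy k_def rxy.
  have rE : box_row x = box_row y by lia.
  by rewrite (box_eq rE cxy) addn0.
have lt_y : (box_col y < nth 0%N al (box_row y).-1)%N.
  by apply: (leq_trans (box_col_lt y)); apply: nth_partition; rewrite // leq_pred.
have [w [rw cw]] := exists_box lt_y.
have := IHk w; rewrite rw cw cxy => /(_ erefl) IH.
have /(_ cw) := @ssyt_col t w y; rewrite rw.
by have := IH; lia.
Qed.

Lemma ssyt_row_le t x : (box_row x <= val t x)%N.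
Proof.
have lt_x : (box_col x < nth 0%N al 0)%N by rewrite nth0 box_col_head.
have [w [rw cw]] := exists_box lt_x.
by have := ssyt_col_growth t cw; rewrite rw subn0 => /(_ isT); lia.
Qed.

End TableauOrder.

(** * Eigenspaces and multiplicities *)

Section Eigenvectors.
Variables (F : fieldType) (W : vectType F) (g : 'End(W)).

Definition eigen (chi : F) : {vspace W} := lker (g - chi *: \1)%VF.

Lemma eigenP chi z : reflect (g z = chi *: z) (z \in eigen chi).
Proof.
rewrite memv_ker add_lfunE opp_lfunE scale_lfunE id_lfunE subr_eq0.
exact: eqP.
Qed.

Variables (A : finType) (P : pred A) (v : A -> W) (chi : A -> F).
Hypothesis g_v : forall a, P a -> g (v a) = chi a *: v a.

(** Peel off one line at a time.  If [z = k v_a + y], then [g z - chi a z] is both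
[(chi0 - chi a) z] and an element of the remaining span, which is stable under
[g]; hence [z] lies in that span. *)
Lemma eigen_other (chi0 : F) (s : seq A) z :
  (forall a, a \in s -> P a && (chi a != chi0)) ->
  z \in (\sum_(a <- s) <[v a]>)%VS -> g z = chi0 *: z -> z = 0.
Proof.
have stable (r : seq A) y : (forall a, a \in r -> P a) ->
    y \in (\sum_(a <- r) <[v a]>)%VS -> g y \in (\sum_(a <- r) <[v a]>)%VS.
  elim: r y => [|a r IHr] y rP; first by rewrite big_nil !memv0 => /eqP ->; rewrite linear0.
  rewrite big_cons => /memv_addP[_ /vlineP[k ->] [y' y'r ->]].
  rewrite linearD linearZ /= g_v ?rP ?mem_head // scalerA memv_add //.
    by rewrite memvZ // memv_line.
  by apply: IHr => // b br; rewrite rP // inE br orbT.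
elim: s z => [|a s IHs] z sP; first by rewrite big_nil memv0 => /eqP.
have sP' b : b \in s -> P b && (chi b != chi0).
  by move=> bs; apply: sP; rewrite inE bs orbT.
rewrite big_cons => /memv_addP[_ /vlineP[k ->] [y ys zE]] gz.
apply: IHs => //; have /andP[Pa neq] := sP a (mem_head _ _).
have neq' : chi0 - chi a != 0 by rewrite subr_eq0 eq_sym.
rewrite -[z](scalerK neq') memvZ // scalerBl -gz {1}zE linearD linearZ /= g_v //.
rewrite zE scalerDr !scalerA mulrC opprD addrACA subrr add0r.
by rewrite memvB ?memvZ // stable // => b /sP'/andP[].
Qed.

(** The vectors with other eigenvalues span a subspace that meets the eigenspace
trivially, and the codimension of that subspace is at most the number of the
remaining vectors. *)
Lemma dim_eigen_le (chi0 : F) : spanning P v ->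
  (\dim (eigen chi0) <= #|[set a | P a && (chi a == chi0)]|)%N.
Proof.
move=> v_span.
pose S := (\sum_(a | P a && (chi a == chi0)) <[v a]>)%VS.
pose S' := (\sum_(a | P a && (chi a != chi0)) <[v a]>)%VS.
have full : (fullv <= S + S')%VS.
  apply/subvP=> z _; have [c ->] := v_span z.
  rewrite (bigID (fun a => chi a == chi0)) /= memv_add //.
    by apply: memv_sumr => a _; rewrite memvZ // memv_line.
  by apply: memv_sumr => a _; rewrite memvZ // memv_line.
have cap0 : (eigen chi0 :&: S')%VS = 0%VS.
  apply/eqP; rewrite -subv0; apply/subvP=> z /memv_capP[/eigenP gz zS].
  rewrite memv0; apply/eqP; apply: (@eigen_other chi0 (enum [pred a | P a && (chi a != chi0)])) gz.
    by move=> a; rewrite mem_enum.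
  by rewrite big_enum.
have dimS : (\dim S <= #|[set a | P a && (chi a == chi0)]|)%N.
  apply: leq_trans (dimv_leq_sum _ _ _) _; rewrite -sum1_card.
  rewrite [X in (_ <= X)%N](eq_bigl (fun a => P a && (chi a == chi0))); last first.
    by move=> a; rewrite inE.
  by apply: leq_sum => a _; rewrite dim_vline; case: (_ == _).
have := dimv_sum_cap (eigen chi0) S'; rewrite cap0 dimv0 addn0.
have := dimvS (subv_trans (subvf (eigen chi0 + S')) full).
by have := dimv_add_leqif S S' => -[le_d _]; lia.
Qed.

End Eigenvectors.

Section Multiplicity.
Variables (F : fieldType) (E : vectType F) (W V : GLrep E).

(** Each summand isomorphic to [V] contains the image of [z], and vectors taken
from distinct summands are independent. *)
Lemma multiplicity_le_eigen (g : 'End(E)) (chi0 : F) (z : V) (c : nat) :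
  in_GL g -> z != 0 -> rep_act V g z = chi0 *: z -> has_multiplicity W V c ->
  (c <= \dim (eigen (rep_act W g) chi0))%N.
Proof.
move=> gG z0 gz [k [U [[irr dir _] ->]]].
set S := [set i | _].
have /boolp.choice [w Hw] : forall i, exists w, i \in S ->
    [/\ w \in U i, w != 0 & w \in eigen (rep_act W g) chi0].
  move=> i; case: (boolP (i \in S)) => [|_]; last by exists 0.
  rewrite inE => /asboolP[phi [ker0 img eqv]]; exists (phi z) => _; split.
  - by rewrite -img memv_img ?memvf.
  - apply: contra z0 => /eqP phiz; have : z \in lker phi by rewrite memv_ker phiz.
    by rewrite ker0 memv0.
  apply/eigenP; have := congr1 (fun h => fun_of_lfun h z) (eqv g gG).
  by rewrite !comp_lfunE gz linearZ.
have dirS : directv (\sum_(i in S) <[w i]>).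
  apply/directv_sum_independent => us us_in sum0 i iS.
  have /directv_sum_independent/(_ (fun i => if i \in S then us i else 0)) := dir.
  move=> /(_ _ _ i isT); rewrite iS; apply.
    move=> j _; case: (boolP (j \in S)) => jS; last exact: mem0v.
    by have [wU _ _] := Hw j jS; have /vlineP[a ->] := us_in j jS; rewrite memvZ.
  by rewrite -big_mkcond.
have : (\sum_(i in S) <[w i]> <= eigen (rep_act W g) chi0)%VS.
  by apply/subv_sumP=> i iS; have [_ _ wK] := Hw i iS; rewrite -memvE.
move/dimvS; apply: leq_trans; rewrite (directvP dirS) /= -sum1_card.
by apply: leq_sum => i iS; have [_ w0 _] := Hw i iS; rewrite dim_vline w0.
Qed.

Lemma multiplicity_zero (c : nat) :
  (forall z : V, z = 0) -> has_multiplicity W V c -> c = 0%N.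
Proof.
move=> V0 [k [U [[irr _ _] ->]]]; apply/eqP; rewrite cards_eq0; apply/eqP/setP=> i.
rewrite !inE; apply/asboolP => -[phi [_ img _]]; have [U0 _ _] := irr i; case/eqP: U0.
apply/eqP; rewrite -img -subv0; apply/subvP=> _ /memv_imgP[z _ ->].
by rewrite (V0 z) linear0 mem0v.
Qed.

End Multiplicity.

(** * Weight vectors *)

Section SchurEigen.
Variables (F : numFieldType) (A : finType) (al : seq nat) (V : vectType F).
Variables (v : A -> V) (g : 'End(V)) (chi : A -> F).
Hypothesis g_v : forall a, g (v a) = chi a *: v a.

Lemma young_tensorE (T : {ffun box al -> A}) :
  young_tensor v T = young_symmetrizer al V (pure (v \o T)).
Proof. by rewrite lfunE. Qed.

Lemma schur_map_vector (T : {ffun box al -> A}) :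
  schur_map al g (schur_vector v T) = (\prod_x chi (T x)) *: schur_vector v T.
Proof.
apply: val_inj; rewrite /= schur_mapE schur_vectorK young_tensorE tensor_map_young.
rewrite tensor_map_pure -linearZ -pure_scale; congr (young_symmetrizer _ _ _).
by apply: eq_pure => x /=; rewrite g_v.
Qed.
End SchurEigen.

Section Torus.
Variables (F : numFieldType) (E : vectType F).
Notation d := (\dim {:E}).
Notation e := (fun b : 'I_d => (vbasis {:E})`_b).
Variable (p : 'I_d -> F).

(** The diagonal matrix with entries [p] in the chosen basis of [E]. *)
Definition torus_fun (z : E) : E :=
  \sum_b (coord (vbasis {:E}) b z * p b) *: (vbasis {:E})`_b.

Fact torus_is_linear : linear torus_fun.
Proof.
move=> a y z; rewrite /torus_fun scaler_sumr -big_split; apply: eq_bigr => b _ /=.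
by rewrite linearP /= mulrDl scalerDl -!mulrA scalerA.
Qed.
HB.instance Definition _ :=
  GRing.isLinear.Build F E E _ torus_fun torus_is_linear.

Definition torus : 'End(E) := linfun torus_fun.

Lemma coord_basis (b c : 'I_d) :
  coord (vbasis {:E}) b (vbasis {:E})`_c = (b == c)%:R.
Proof. by rewrite coord_free ?(basis_free (vbasisP _)) // eq_sym. Qed.

Lemma torus_basis (b : 'I_d) : torus (vbasis {:E})`_b = p b *: (vbasis {:E})`_b.
Proof.
rewrite lfunE /= /torus_fun (bigD1 b) //= big1 => [|c cb].
  by rewrite coord_basis eqxx mul1r addr0.
by rewrite coord_basis (negPf cb) mul0r scale0r.
Qed.

Lemma torus_GL : (forall b, p b != 0) -> in_GL torus.
Proof.
move=> p0; rewrite /in_GL -subv0; apply/subvP=> z.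
rewrite memv_ker lfunE /= memv0 => /eqP gz; apply/eqP.
rewrite (coord_vbasis (memvf z)) big1 // => b _.
have : coord (vbasis {:E}) b (torus_fun z) = 0 by rewrite gz linear0.
rewrite linear_sum (bigD1 b) //= big1 => [|c cb].
  rewrite linearZ /= coord_basis eqxx mulr1 addr0 => /eqP.
  by rewrite mulf_eq0 (negPf (p0 b)) orbF => /eqP ->; rewrite scale0r.
by rewrite linearZ /= coord_basis eq_sym (negPf cb) mulr0.
Qed.

Lemma vbasis_spanning : spanning predT e.
Proof.
by move=> z; exists (fun b => coord (vbasis {:E}) b z); apply: coord_vbasis (memvf z).
Qed.

End Torus.

Lemma prod_monomial (F : fieldType) (I J : finType) (x : J -> F) (f : I -> J) :
  \prod_i x (f i) = \prod_j x j ^+ #|[set i | f i == j]|.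
Proof.
rewrite (partition_big f predT) //=; apply: eq_bigr => j _.
rewrite (eq_bigr (fun => x j)) => [|i /eqP->] //.
by rewrite prodr_const; congr (_ ^+ _); apply: eq_card => i; rewrite !inE.
Qed.

Lemma distinct_primes :
  exists q : nat -> nat, (forall i, prime (q i)) /\ injective q.
Proof.
pose q i := iter i (fun m => s2val (prime_above m)) 2%N.
have q_prime i : prime (q i).
  by case: i => // i; rewrite /q iterS; case: prime_above.
have q_incr i : (q i < q i.+1)%N by rewrite /q iterS; case: prime_above.
exists q; split=> //; apply: incn_inj; apply: leq_mono.
exact: (homo_ltn ltn_trans q_incr).
Qed.

(** Unique factorization: a single torus element with distinct prime entries
separates weights. *)
Lemma prod_primes_inj (I : finType) (q : I -> nat) (a b : I -> nat) :
  injective q -> (forall i, prime (q i)) ->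
  (\prod_i q i ^ a i = \prod_i q i ^ b i)%N -> a =1 b.
Proof.
move=> q_inj q_prime; have logE (c : I -> nat) j : logn (q j) (\prod_i q i ^ c i)%N = c j.
  suff [_ ->] : (0 < \prod_i q i ^ c i)%N /\
      logn (q j) (\prod_i q i ^ c i)%N = (\sum_i (if i == j then c i else 0))%N.
    by rewrite -big_mkcond big_pred1_eq.
  apply: (big_ind2 (fun n k => (0 < n)%N /\ logn (q j) n = k)) => [|n k n' k' [n0 <-] [n'0 <-]|i _]; first by rewrite logn1.
    by rewrite muln_gt0 n0 n'0 lognM //.
  rewrite expn_gt0 prime_gt0 // lognX logn_prime // (inj_eq q_inj) [j == i]eq_sym; split=> //.
  by case: eqP => _; rewrite ?muln1 ?muln0.
by move=> eqp j; rewrite -(logE a) eqp logE.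
Qed.

Section HighestWeight.
Variables (F : numFieldType) (E : vectType F) (ka : seq nat).
Notation d := (\dim {:E}).
Hypothesis ka_size : (size ka <= d)%N.

(** The filling with every entry equal to its row index, whose weight is [ka]. *)
Definition row_filling : {ffun box ka -> 'I_d} :=
  [ffun x => widen_ord ka_size (tag x)].

(** The coefficient of the basis tensor [row_filling] in its own symmetrization is
the order of the row group: a product of a row and a column permutation
preserves all rows only if the column permutation is trivial. *)
Lemma row_filling_neq0 : young_tensor (fun b : 'I_d => (vbasis {:E})`_b) row_filling != 0.
Proof.
apply/eqP=> /(congr1 (fun t : tensor _ _ => t row_filling)).
have valE (s : {perm box ka}) :
   place s (pure (fun x => (vbasis {:E})`_(row_filling x))) row_filling =
   (s \in row_group ka)%:R :> F.
  rewrite ffunE pure_basis; congr (_%:R); congr nat_of_bool.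
  apply/eqP/row_groupP => [H x | H].
    by have := congr1 (fun f : {ffun _ -> _} => val (f x)) H; rewrite !ffunE.
  by apply/ffunP=> x; rewrite !ffunE; apply: val_inj; apply: H.
rewrite /young_tensor /young_fun sum_ffunE.
under eq_bigr => s sR.
  rewrite sum_ffunE (bigD1 1%g) /=; last by apply/col_groupP => x; rewrite perm1.
  rewrite big1 ?addr0 => [|u /andP[uC u1]]; last first.
    rewrite placeM ffunE valE; case: (boolP (_ \in _)) => [|_]; last by rewrite scaler0.
    move=> /row_groupP usR; case/eqP: u1; apply/permP => x; rewrite perm1.
    apply: box_eq; last exact: (col_groupP _ uC).
    by have := usR x; rewrite permM (row_groupP _ sR).
  rewrite placeM mul1g odd_perm1 ffunE valE sR; over.
rewrite sumr_const ffunE => /eqP; rewrite expr0 scale1r pnatr_eq0 => /eqP/card0_eq/(_ 1%g).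
by rewrite !inE => /negP[]; apply/forallP=> x; rewrite perm1.
Qed.

End HighestWeight.

Lemma nth_weight (d : nat) (nu al : seq nat) (T : {ffun box nu -> ssyt_type d al}) (b : 'I_d) :
  nth 0%N (weight T) b = (\sum_x #|[set y | val (T x) y == b]|)%N.
Proof. by rewrite (nth_map b) ?size_enum_ord // nth_ord_enum. Qed.

Section MultiplicityBound.
Variables (F : numFieldType) (E : vectType F) (al nu ka : seq nat).
Notation d := (\dim {:E}).
Notation e := (fun b : 'I_d => (vbasis {:E})`_b).
Hypothesis al_sorted : sorted geq al.

Lemma schur_spanning_ssyt :
  spanning predT (fun t : ssyt_type d al => schur_vector e (val t)).
Proof.
move=> z; have [] := schur_spanning (lt := @ord_lt d) (rk := val) _ _ al_sorted (@vbasis_spanning _ E) z.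
- by [].
- by move=> a b; rewrite /ord_lt -val_eqE /=; lia.
move=> c zE; exists (fun t => c (val t)); rewrite zE.
rewrite (reindex_omap (val : ssyt_type d al -> _) insub) => [|T /= Tss]; last by rewrite insubT.
apply: eq_bigl => t; rewrite /= valK eqxx andbT; exact: valP.
Qed.

Hypothesis nu_sorted : sorted geq nu.
Hypothesis ka_sorted : sorted geq ka.
Hypothesis ka_pos : 0%N \notin ka.

(** There is no semistandard tableau: the entry in row [i], counted from 0, is at
least [i], which leaves nothing for the last row. *)
Lemma schur_small (z : schur ka E) : (d < size ka)%N -> z = 0.
Proof.
move=> lt_d.
have [] := schur_spanning (lt := @ord_lt d) (rk := val) _ _ ka_sorted (@vbasis_spanning _ E) z.
- by [].
- by move=> a b; rewrite /ord_lt -val_eqE /=; lia.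
move=> c ->; rewrite big1 // => T Tss.
have lt_x : (0 < nth 0%N ka (size ka).-1)%N.
  rewrite lt0n; apply: contraNneq ka_pos => <-.
  by rewrite mem_nth // prednK // (leq_trans _ lt_d).
have [x [rx _]] := exists_box lt_x.
have := ssyt_row_le ka_sorted (Sub T Tss : ssyt_type d ka) x; rewrite rx /= => le_x.
have := leq_ltn_trans le_x (ltn_ord (T x)); rewrite ltnNge -ltnS prednK ?lt_d //.
exact: leq_ltn_trans (leq0n _) lt_d.
Qed.

(** Compare the torus eigenvalue of a highest weight vector with those of the
spanning family of tableau vectors, obtained by straightening twice. *)
Lemma multiplicity_le_ssyt (c : nat) :
  has_multiplicity (schur_rep nu (schur_rep al (natural_rep E)))
    (schur_rep ka (natural_rep E)) c ->
  (c <= #|[set T in SSYT (@ssyt_lt d al) nu | eq_composition (weight T) ka]|)%N.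
Proof.
move=> multc; case: (leqP (size ka) d) => [le_d | lt_d]; last first.
  by rewrite (multiplicity_zero _ multc) // => z; apply: schur_small.
have [q [q_prime q_inj]] := distinct_primes.
pose p (b : 'I_d) : F := (q b)%:R.
have p0 b : p b != 0 by rewrite pnatr_eq0 -lt0n prime_gt0.
pose w (t : ssyt_type d al) : schur al E := schur_vector e (val t).
pose chi (t : ssyt_type d al) : F := \prod_y p (val t y).
have w_eigen t : schur_map al (torus p) (w t) = chi t *: w t.
  by apply: schur_map_vector => b; apply: torus_basis.
have high : schur_map ka (torus p) (schur_vector e (row_filling le_d)) =
    (\prod_b p b ^+ nth 0%N ka b) *: schur_vector e (row_filling le_d).
  rewrite (schur_map_vector (torus_basis p)).
  congr (_ *: _); rewrite prod_monomial; apply: eq_bigr => b _; congr (_ ^+ _).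
  by rewrite -card_row; apply: eq_card => x; rewrite !inE ffunE.
have high0 : schur_vector e (row_filling le_d) != 0.
  apply: contra (row_filling_neq0 le_d) => /eqP/(congr1 vsval).
  by rewrite schur_vectorK => ->; rewrite linear0.
have c_le := @multiplicity_le_eigen _ _ _ (schur_rep ka (natural_rep E))
  _ _ _ _ (torus_GL p0) high0 high multc.
apply: (leq_trans c_le) => {c_le}.
have w_span := schur_spanning (@ssyt_lt_rank d al) (@ssyt_lt_total d al al_sorted)
  nu_sorted schur_spanning_ssyt.
set chi0 := \prod_b _.
have dim_le := dim_eigen_le (fun T _ => schur_map_vector w_eigen T) chi0 w_span.
apply: (leq_trans dim_le).
apply: subset_leq_card; apply/subsetP=> T; rewrite !inE => /andP[-> /eqP chiT] /=.
have wtT (b : 'I_d) : nth 0%N (weight T) b = nth 0%N ka b.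
  apply: (@prod_primes_inj _ (fun b : 'I_d => q b) (fun b : 'I_d => nth 0%N (weight T) b)
           (fun b : 'I_d => nth 0%N ka b)) b => [b c' /q_inj/val_inj // | // |].
  apply/eqP; rewrite -(eqr_nat F) !natr_prod; apply/eqP.
  under [RHS]eq_bigr => b _ do rewrite natrX.
  rewrite -[RHS]chiT /chi.
  under [RHS]eq_bigr => x _ do rewrite prod_monomial.
  rewrite exchange_big; apply: eq_bigr => b _.
  by rewrite natrX nth_weight -expr_sum.
apply/allP=> i _; apply/eqP; case: (ltnP i d) => [lt_i | le_i].
  exact: wtT (Ordinal lt_i).
rewrite nth_default; last by rewrite /weight size_map size_enum_ord.
rewrite nth_default //.
exact: leq_trans le_d le_i.
Qed.

End MultiplicityBound.

(** * Removing columns from the inner tableaux *)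

(** The shape [al] arises from [be] by inserting [K] columns of height [r] at
positions [q], ..., [q + K - 1].  The bounds on the rows of [be] say that this is
where columns of height [r] belong. *)
Section ColumnRemoval.
Local Open Scope nat_scope.
Variables (d r K q : nat) (al be : seq nat).
Hypothesis alE : forall i, nth 0 al i = nth 0 be i + (if i < r then K else 0).
Hypothesis be_top : forall i, i < r -> q <= nth 0 be i.
Hypothesis be_bottom : forall i, r <= i -> nth 0 be i <= q.

Definition shift_col (j : nat) : nat := if j < q then j else j + K.

Lemma shift_col_lt i j : (shift_col j < nth 0 al i) = (j < nth 0 be i).
Proof.
rewrite alE /shift_col; case: (ltnP i r) => [/be_top | /be_bottom]; case: ifP; lia.
Qed.

Lemma shift_col_mono j k : (shift_col j < shift_col k) = (j < k).
Proof. by rewrite /shift_col; do 2 case: ifP; lia. Qed.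

Lemma shift_col_inj : injective shift_col.
Proof. by move=> j k; rewrite /shift_col; do 2 case: ifP; lia. Qed.

(** The columns of [al] that are missing from [be]. *)
Definition inserted (j : nat) : bool := q <= j < q + K.

Lemma shift_colP j : ~~ inserted j -> exists j', j = shift_col j'.
Proof.
rewrite /inserted negb_and -ltnNge -leqNgt => /orP[lt_j | le_j].
  by exists j; rewrite /shift_col lt_j.
by exists (j - K); rewrite /shift_col ifF; lia.
Qed.

Fact grow_subproof (x : box be) : shift_col (box_col x) < nth 0 al (box_row x).
Proof. by rewrite shift_col_lt box_col_lt. Qed.

Definition grow (x : box be) : box al := box_at (grow_subproof x).

Lemma grow_row x : box_row (grow x) = box_row x. Proof. by []. Qed.
Lemma grow_col x : box_col (grow x) = shift_col (box_col x). Proof. by []. Qed.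

Lemma grow_inj : injective grow.
Proof.
move=> x y eqg; apply: box_eq; first by rewrite -!grow_row eqg.
by apply: shift_col_inj; rewrite -!grow_col eqg.
Qed.

Lemma not_insertedP (x : box al) : ~~ inserted (box_col x) -> exists y, x = grow y.
Proof.
move=> /shift_colP[j colx]; have := box_col_lt x; rewrite colx shift_col_lt.
move=> /exists_box[y [ry cy]]; exists y.
by apply: box_eq; rewrite ?grow_row ?grow_col ?ry ?cy.
Qed.

Lemma inserted_grow y : inserted (box_col (grow y)) = false.
Proof. by rewrite grow_col /inserted /shift_col; case: ifP; lia. Qed.

Lemma inserted_row (x : box al) : inserted (box_col x) -> box_row x < r.
Proof.
move=> /andP[q_le _]; rewrite ltnNge; apply/negP=> r_le.
have := box_col_lt x; rewrite alE [_ < r]ltnNge r_le addn0.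
by have := be_bottom r_le; lia.
Qed.

Implicit Types t u : ssyt_type d al.

Fact remove_subproof t :
  [ffun x => val t (grow x)] \in SSYT (@ord_lt d) be.
Proof.
rewrite inE; apply/andP; split; apply/forallP=> x; apply/forallP=> y; apply/implyP.
  move=> /andP[/eqP rxy cxy]; rewrite !ffunE /ord_lt -val_eqE /= -leq_eqVlt.
  by apply: ssyt_row; rewrite ?grow_row // !grow_col ltnW // shift_col_mono.
move=> /andP[/eqP cxy rxy]; rewrite !ffunE.
by apply: ssyt_col; rewrite ?grow_row // !grow_col cxy.
Qed.

Definition remove_columns t : ssyt_type d be :=
  exist (fun T => T \in SSYT (@ord_lt d) be) _ (remove_subproof t).

Lemma remove_columnsE t x : val (remove_columns t) x = val t (grow x).
Proof. by rewrite ffunE. Qed.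

(** The inserted columns carry the least possible entries, so they can be restored
after deletion. *)
Definition initial_columns t : Prop :=
  forall x, inserted (box_col x) -> val t x = box_row x :> nat.

Lemma remove_columns_inj t u : initial_columns t -> initial_columns u ->
  remove_columns t = remove_columns u -> t = u.
Proof.
move=> t_in u_in eqr; apply: val_inj; apply/ffunP=> x.
case: (boolP (inserted (box_col x))) => [x_in | /not_insertedP[y ->]].
  by apply: val_inj; rewrite /= t_in // u_in.
by rewrite -!remove_columnsE eqr.
Qed.

Lemma col_set_remove t j : col_set (remove_columns t) j = col_set t (shift_col j).
Proof.
apply/setP=> e; apply/col_setP/col_setP => -[x cx tx].
  by exists (grow x); rewrite ?grow_col ?cx // -remove_columnsE.
have /not_insertedP[y xE] : ~~ inserted (box_col x).
  by rewrite cx /inserted /shift_col; case: ifP; lia.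
exists y; last by rewrite remove_columnsE -xE.
by apply: shift_col_inj; rewrite -grow_col -xE.
Qed.

Lemma col_set_initial t u j : initial_columns t -> initial_columns u ->
  inserted j -> col_set t j = col_set u j.
Proof.
move=> t_in u_in j_in; apply/setP=> e.
by apply/col_setP/col_setP => -[x cx <-]; exists x => //; apply: val_inj;
  rewrite /= t_in ?u_in ?cx.
Qed.

(** The rightmost column in which [t] and [u] differ is not an inserted one. *)
Lemma remove_columns_lt t u : initial_columns t -> initial_columns u ->
  ssyt_lt t u -> ssyt_lt (remove_columns t) (remove_columns u).
Proof.
move=> t_in u_in /existsP[j /and3P[neq /forallP above last_diff]].
have [|j' jE] := @shift_colP j.
  by apply: contra neq => j_in; rewrite (col_set_initial t_in u_in j_in).
have head_lt k : (shift_col k < head 0 al) = (k < head 0 be).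
  by rewrite -!nth0 shift_col_lt.
have lt_j' : j' < head 0 be by rewrite -head_lt -jE.
apply/existsP; exists (Ordinal lt_j'); rewrite !col_set_remove /= -jE neq last_diff.
rewrite andbT /=; apply/forallP=> k; apply/implyP=> lt_k; rewrite !col_set_remove.
have lt_k' : shift_col k < head 0 al by rewrite head_lt.
by have /implyP/= := above (Ordinal lt_k'); apply; rewrite /= jE shift_col_mono.
Qed.

Lemma count_remove t (b : 'I_d) : initial_columns t ->
  #|[set y | val t y == b]| =
  #|[set y | val (remove_columns t) y == b]| + (if b < r then K else 0).
Proof.
move=> t_in; rewrite -(cardsID [set y | ~~ inserted (box_col y)]); congr (_ + _).
  rewrite -(card_imset _ grow_inj); apply: eq_card => x; rewrite !inE.
  apply/andP/imsetP => [[tx /not_insertedP[y xE]] | [y]].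
    by exists y; rewrite // inE remove_columnsE -xE.
  by rewrite inE remove_columnsE => ty ->; rewrite inserted_grow.
case: ifP => [lt_b | ge_b]; last first.
  apply: eq_card0 => x; rewrite !inE negbK; apply/negP=> /andP[x_in /eqP tx].
  by have := inserted_row x_in; rewrite -(t_in x x_in) tx ge_b.
transitivity #|[set x : box al | (box_row x == b) && (box_col x < q + K)]
               :\: [set x | (box_row x == b) && (box_col x < q)]|.
  apply: eq_card => x; rewrite !inE negbK.
  case: (boolP (inserted (box_col x))) => [x_in | x_out] /=.
    rewrite -val_eqE /= t_in //; move: x_in; rewrite /inserted.
    by case: (_ == _) => //=; lia.
  by move: x_out; rewrite /inserted; case: (_ == _) => //=; lia.
rewrite cardsDS ?card_row_left; last first.
  by apply/subsetP=> x; rewrite !inE => /andP[->] /=; lia.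
by have := be_top lt_b; rewrite alE lt_b; lia.
Qed.

Lemma eq_compositionP (a b : seq nat) :
  reflect (forall i, nth 0 a i = nth 0 b i) (eq_composition a b).
Proof.
apply: (iffP allP) => H i; last by rewrite H.
case: (ltnP i (maxn (size a) (size b))) => [lt_i | ].
  by apply/eqP/H; rewrite mem_iota.
by rewrite geq_max => /andP[ia ib]; rewrite !nth_default.
Qed.

Lemma nth_weight_default (nu : seq nat) (T : {ffun box nu -> ssyt_type d al}) i :
  d <= i -> nth 0 (weight T) i = 0.
Proof. by move=> le_i; rewrite nth_default // /weight size_map size_enum_ord. Qed.

Section Plethysm.
Variables (nu ka ka' : seq nat).
Hypothesis r_le_d : r <= d.
Hypothesis kaE : forall i, nth 0 ka i = nth 0 ka' i + (if i < r then #|box nu| * K else 0).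

(** The injection deletes the inserted columns of every inner tableau.  The outer
tableau stays semistandard because equality and strict order of initial inner
tableaux survive the deletion. *)
Lemma remove_columns_card :
  (forall (T : {ffun box nu -> ssyt_type d al}) z,
     eq_composition (weight T) ka -> initial_columns (T z)) ->
  #|[set T in SSYT (@ssyt_lt d al) nu | eq_composition (weight T) ka]| <=
  #|[set T in SSYT (@ssyt_lt d be) nu | eq_composition (weight T) ka']|.
Proof.
move=> initial.
pose f (T : {ffun box nu -> ssyt_type d al}) := [ffun z => remove_columns (T z)].
rewrite -(@card_in_imset _ _ f); last first.
  move=> T S; rewrite !inE => /andP[_ wtT] /andP[_ wtS] eqf; apply/ffunP=> z.
  apply: remove_columns_inj; [exact: initial | exact: initial|].
  by have := congr1 (fun g : {ffun _ -> _} => g z) eqf; rewrite !ffunE.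
apply/subset_leq_card/subsetP=> _ /imsetP[T + ->]; rewrite !inE.
move=> /andP[/andP[/forallP rows /forallP cols] wtT]; have inT z := initial T z wtT.
apply/andP; split; first apply/andP; first split.
- apply/forallP=> x; apply/forallP=> y; apply/implyP=> xy; rewrite !ffunE.
  have /forallP/(_ y)/implyP/(_ xy)/orP[/eqP -> | ltxy] := rows x; first by rewrite eqxx.
  by rewrite remove_columns_lt ?orbT.
- apply/forallP=> x; apply/forallP=> y; apply/implyP=> xy; rewrite !ffunE.
  by have /forallP/(_ y)/implyP/(_ xy) := cols x; apply: remove_columns_lt.
apply/eq_compositionP => i; move/eq_compositionP/(_ i): wtT.
case: (ltnP i d) => [lt_i | le_i].
  rewrite kaE !(nth_weight _ (Ordinal lt_i)) /=.
  under eq_bigr => x _ do rewrite count_remove //.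
  rewrite big_split /= sum_nat_const.
  under [in X in _ -> X]eq_bigr => x _ do rewrite ffunE.
  by case: (i < r); rewrite ?muln0 => /eqP; rewrite ?eqn_add2r => /eqP.
rewrite nth_weight_default // kaE ltnNge (leq_trans r_le_d le_i) addn0 => <-.
by rewrite nth_default // /weight size_map size_enum_ord.
Qed.

End Plethysm.

Hypothesis al_sorted : sorted geq al.
Hypothesis r_gt0 : 0 < r.
Hypothesis r_le_d : r <= d.

(** Entries are counted from 0, so these are the entries 1, ..., [r] of the usual
alphabet. *)
Definition low_count t : nat := #|[set y | val t y < r]|.

Lemma low_count_le t : low_count t <= \sum_(0 <= i < r) nth 0 al i.
Proof.
rewrite -card_rows_above; apply/subset_leq_card/subsetP=> y; rewrite !inE.
exact: leq_ltn_trans (ssyt_row_le al_sorted t y).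
Qed.

(** If an inserted column [j] is not initial, its entry in row [r - 1] is at least
[r], and so are all the entries to the right of it in that row.  The entries
below [r] then lie in the first [r - 1] rows or in the first [j] boxes of
row [r - 1], and [j < q + K]. *)
Lemma low_count_lt t : ~ initial_columns t ->
  low_count t < \sum_(0 <= i < r.-1) nth 0 al i + (q + K).
Proof.
move=> not_in; have [x [x_in tx]] : exists x, inserted (box_col x) /\ val t x <> box_row x :> nat.
  apply: contrapT => none; apply: not_in => x x_in; apply: contrapT => tx.
  by apply: none; exists x.
have lt_r : r.-1 < r by rewrite ltn_predL.
have [/andP[q_le lt_K] row_lt] := (x_in, inserted_row x_in).
have lt_x : box_col x < nth 0 al r.-1.
  by rewrite alE lt_r; have := be_top lt_r; lia.
have [w [rw cw]] := exists_box lt_x.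
have tw : r <= val t w.
  have := ssyt_col_growth al_sorted t (esym cw); rewrite rw.
  by have := ssyt_row_le al_sorted t x; lia.
apply: (@leq_ltn_trans (\sum_(0 <= i < r.-1) nth 0 al i + box_col x)); last first.
  by rewrite ltn_add2l.
rewrite -card_rows_above.
apply: (@leq_trans #|[set y : box al | box_row y < r.-1] :|:
   [set y : box al | (box_row y == r.-1) && (box_col y < box_col x)]|).
  apply/subset_leq_card/subsetP=> y; rewrite !inE => ty.
  have := leq_ltn_trans (ssyt_row_le al_sorted t y) ty.
  rewrite -[r in _ < r](prednK r_gt0) ltnS leq_eqVlt => /orP[/eqP ry | -> //].
  rewrite ry eqxx ltnn /= ltnNge; apply: contraL ty => cxy; rewrite -leqNgt.
  by apply: leq_trans tw _; apply: ssyt_row; rewrite ?ry ?cw.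
rewrite cardsU card_row_left; apply: leq_trans (leq_subr _ _) _.
by rewrite leq_add2l geq_minl.
Qed.

(** One inner tableau violating [initial_columns] would leave the total number of
entries below [r] short of what the weight prescribes. *)
Lemma initial_columns_of_weight (nu ka : seq nat)
    (T : {ffun box nu -> ssyt_type d al}) z :
  #|box nu|.-1 * (\sum_(0 <= i < r) nth 0 al i) +
    (\sum_(0 <= i < r.-1) nth 0 al i + (q + K)) <= \sum_(0 <= i < r) nth 0 ka i ->
  eq_composition (weight T) ka -> initial_columns (T z).
Proof.
move=> ka_large /eq_compositionP wtT; apply: contrapT => not_in.
have := low_count_lt not_in.
suff : \sum_(0 <= i < r) nth 0 ka i <=
       #|box nu|.-1 * (\sum_(0 <= i < r) nth 0 al i) + low_count (T z) by lia.
have -> : \sum_(0 <= i < r) nth 0 ka i = \sum_x low_count (T x).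
  transitivity (\sum_(b < d | b < r) \sum_x #|[set y | val (T x) y == b]|).
    rewrite big_mkord (big_ord_widen d (fun i => nth 0 ka i) r_le_d).
    by apply: eq_bigr => b _; rewrite -wtT nth_weight.
  rewrite exchange_big; apply: eq_bigr => x _ /=; rewrite /low_count -sum1_card.
  rewrite (partition_big (fun y => val (T x) y) (fun b : 'I_d => b < r)) /=.
    apply: eq_bigr => b lt_b; rewrite -sum1_card; apply: eq_bigl => y.
    by rewrite !inE; case: eqP => [->|_]; rewrite ?lt_b ?andbF.
  by move=> y; rewrite inE.
rewrite (bigD1 z) //= addnC leq_add2r.
apply: (@leq_trans (\sum_(x | x != z) \sum_(0 <= i < r) nth 0 al i)).
  by apply: leq_sum => x _; apply: low_count_le.
rewrite sum_nat_const leq_mul2r; apply/orP; right.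
by rewrite -(cardC1 z); apply/eq_leq/eq_card.
Qed.

End ColumnRemoval.

(** * Adding rectangles to partitions *)

Section PartitionArithmetic.
Local Open Scope nat_scope.
Implicit Types al be s : seq nat.

Lemma geq_trans : transitive geq.
Proof. by move=> a b c ba ac; apply: leq_trans ba. Qed.

Lemma nth_filter_pos s i : sorted geq s ->
  nth 0 [seq p <- s | 0 < p] i = nth 0 s i.
Proof.
elim: s i => //= x s IHs i x_s; case: ifP => [_ | /negbT].
  by case: i => //= i; apply: IHs; apply: path_sorted x_s.
rewrite -eqn0Ngt => /eqP x0; rewrite IHs ?(path_sorted x_s) //.
have s0 j : nth 0 s j = 0.
  case: (ltnP j (size s)) => [lt_j | /(nth_default 0) //].
  have /allP/(_ _ (mem_nth 0 lt_j)) := order_path_min geq_trans x_s.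
  by rewrite x0 /= leqn0 => /eqP.
by case: i => [|i] /=; rewrite s0 ?x0.
Qed.

Lemma sorted_scale N al : sorted geq al -> sorted geq [seq N * a | a <- al].
Proof. by apply: homo_sorted => a b ab; apply: leq_mul. Qed.

Lemma nth_part_scale N al i : sorted geq al ->
  nth 0 (part_scale N al) i = N * nth 0 al i.
Proof.
move=> al_sorted; rewrite nth_filter_pos ?sorted_scale //.
case: (ltnP i (size al)) => lt_i; first by rewrite (nth_map 0).
by rewrite !nth_default ?size_map ?muln0.
Qed.

Lemma sorted_part_scale N al : sorted geq al -> sorted geq (part_scale N al).
Proof. by move=> al_sorted; apply: sorted_filter geq_trans _ _ (sorted_scale N al_sorted). Qed.

Lemma sorted_add al be : sorted geq al -> sorted geq be ->
  sorted geq (mkseq (fun i => nth 0 al i + nth 0 be i) (maxn (size al) (size be))).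
Proof.
move=> al_sorted be_sorted; apply/(sortedP 0) => i; rewrite size_mkseq => lt_i.
rewrite !nth_mkseq ?(ltnW lt_i) //.
by rewrite /geq /= leq_add // nth_partition.
Qed.

Lemma nth_part_add al be i : sorted geq al -> sorted geq be ->
  nth 0 (part_add al be) i = nth 0 al i + nth 0 be i.
Proof.
move=> al_sorted be_sorted; rewrite nth_filter_pos ?sorted_add //.
case: (ltnP i (maxn (size al) (size be))) => lt_i; first by rewrite nth_mkseq.
rewrite nth_default ?size_mkseq //.
by move: lt_i; rewrite geq_max => /andP[? ?]; rewrite !nth_default.
Qed.

Lemma sorted_part_add al be : sorted geq al -> sorted geq be ->
  sorted geq (part_add al be).
Proof.
move=> al_sorted be_sorted.
exact: sorted_filter geq_trans _ _ (sorted_add al_sorted be_sorted).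
Qed.

Lemma part_add_pos al be : 0 \notin part_add al be.
Proof. by rewrite mem_filter ltnn. Qed.

Lemma sorted_nseq r a : sorted geq (nseq r a).
Proof. by apply/(sortedP 0) => i _; rewrite !nth_nseq; do 2 case: ifP; rewrite /geq /=; lia. Qed.

Lemma nth_add_rectangle al N r a i : sorted geq al ->
  nth 0 (part_add al (part_scale N (nseq r a))) i =
  nth 0 al i + (if i < r then N * a else 0).
Proof.
move=> al_sorted; have rect := sorted_nseq r a.
rewrite nth_part_add ?sorted_part_scale // nth_part_scale // nth_nseq.
by case: ifP; rewrite ?muln0.
Qed.

Lemma sorted_add_rectangle al N r a : sorted geq al ->
  sorted geq (part_add al (part_scale N (nseq r a))).
Proof.
by move=> al_sorted; rewrite sorted_part_add ?sorted_part_scale ?sorted_nseq.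
Qed.

Lemma card_box al : #|box al| = sumn al.
Proof.
rewrite sumnE (big_nth 0) -card_rows_above -cardsT.
by apply: eq_card => x; rewrite !inE; case: x => i j; rewrite /box_row /= ltn_ord.
Qed.

End PartitionArithmetic.

Theorem proposition5p10 (R : realType) (m n : nat) (mu nu lambda : seq nat)
    (r d : nat) (E : vectType R[i]) :
  is_partition_of m mu -> is_partition_of n nu ->
  is_partition_of (m * n)%N lambda ->
  (0 < r)%N ->
  \dim {:E} = d -> (r <= d)%N -> (size mu <= d)%N ->
  let L : nat := absz (Num.max
    ((n%:Z * (\sum_(0 <= i < r.-1) nth 0%N mu i)%N%:Z
      + (n%:Z - 1) * (nth 0%N mu r.-1)%:Z + (nth 0%N mu r)%:Z)
     - (\sum_(0 <= i < r) nth 0%N lambda i)%N%:Z) 0) in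
  forall N c : nat, (L <= N)%N ->
  has_multiplicity
    (schur_rep nu
       (schur_rep (part_add mu (part_scale N (nseq r 1%N))) (natural_rep E)))
    (schur_rep (part_add lambda (part_scale N (nseq r n))) (natural_rep E)) c ->
  (c <= #|[set T in SSYT (@ssyt_lt d (part_add mu (part_scale L (nseq r 1%N)))) nu
           | eq_composition (weight T)
               (part_add lambda (part_scale L (nseq r n)))]|)%N.
Proof.
move=> /and3P[mu_sorted _ _] /and3P[nu_sorted _ /eqP nu_n] /and3P[la_sorted _ _].
move=> r_gt0 dimE r_le_d _ L N c le_LN; subst d => multc.
have := multiplicity_le_ssyt (sorted_add_rectangle N r 1 mu_sorted) nu_sorted
  (sorted_add_rectangle N r n la_sorted) (part_add_pos _ _) multc.
move/leq_trans; apply.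
have muE M i := nth_add_rectangle M r 1 i mu_sorted.
have laE M i := nth_add_rectangle M r n i la_sorted.
pose al M := part_add mu (part_scale M (nseq r 1%N)).
have al_sorted : sorted geq (al N) by apply: sorted_add_rectangle.
have alE i : nth 0%N (al N) i = (nth 0%N (al L) i + (if i < r then N - L else 0))%N.
  by rewrite !muE; case: ifP; rewrite ?addn0 // !muln1; lia.
have al_top i : (i < r)%N -> (nth 0%N mu r <= nth 0%N (al L) i)%N.
  by move=> lt_i; rewrite muE lt_i; have := nth_partition mu_sorted (ltnW lt_i); lia.
have al_bottom i : (r <= i)%N -> (nth 0%N (al L) i <= nth 0%N mu r)%N.
  by move=> le_i; rewrite muE ltnNge le_i addn0; apply: nth_partition.
apply: (remove_columns_card alE al_top al_bottom r_le_d).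
  by move=> i; rewrite !laE card_box nu_n; case: ifP; rewrite ?addn0 //; nia.
move=> T z; apply: (initial_columns_of_weight alE al_top al_bottom al_sorted r_gt0) => //.
have n_gt0 : (0 < n)%N by rewrite -nu_n -card_box; apply/card_gt0P; exists z.
rewrite card_box nu_n.
have sum_rect (M p a : nat) (s t : seq nat) : (p <= r)%N ->
    (forall i, nth 0%N t i = nth 0%N s i + (if (i < r)%N then M * a else 0))%N ->
    (\sum_(0 <= i < p) nth 0%N t i = \sum_(0 <= i < p) nth 0%N s i + p * (M * a))%N.
  move=> le_p tE; rewrite -[X in (_ + X * _)%N]subn0 -sum_nat_const_nat -big_split.
  by apply: eq_big_nat => i /andP[_ lt_i]; rewrite tE (leq_trans lt_i le_p).
rewrite !(sum_rect _ _ _ _ _ (leqnn r) (muE N)) (sum_rect _ _ _ _ _ (leq_pred r) (muE N)).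
rewrite (sum_rect _ _ _ _ _ (leqnn r) (laE N)).
have sumr : (\sum_(0 <= i < r) nth 0%N mu i =
             \sum_(0 <= i < r.-1) nth 0%N mu i + nth 0%N mu r.-1)%N.
  by rewrite -{1}(prednK r_gt0) big_nat_recr.
rewrite sumr.
have L_ge : (n%:Z * (\sum_(0 <= i < r.-1) nth 0%N mu i)%N%:Z
      + (n%:Z - 1) * (nth 0%N mu r.-1)%:Z + (nth 0%N mu r)%:Z)
     - (\sum_(0 <= i < r) nth 0%N lambda i)%N%:Z <= L%:Z.
  by rewrite /L; lia.
move: L_ge le_LN n_gt0 r_gt0; clearbody L; clear.
move: (\sum_(0 <= i < r.-1) _)%N (nth 0%N mu r.-1) (nth 0%N mu r)
  (\sum_(0 <= i < r) _)%N => A B C D.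
by case: n => // n'; case: r => // r' /=; nia.
Qed.
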